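(* Let $\delta>1$, let $\mathtt f_\delta>0$ be the number such that $\delta\sum_{t=1}^\infty q(t)\,e^{-\mathtt f_\delta t}=1$, and let $\mu_\delta:=\sum_{t\ge1}t\,q_\delta(t)<\infty$, where $q_\delta(t):=\delta\,q(t)\,e^{-\mathtt f_\delta t}$. Then, as $N\to\infty$, $$\widetilde Z^{\mathrm c}_{\delta,N}\ \sim\ \frac1{\mu_\delta}\,e^{N\mathtt f_\delta},\qquad\qquad \widetilde Z^{\mathrm f}_{\delta,N}\ \sim\ \Bigg(\frac1{\mu_\delta}\sum_{t=0}^\infty e^{-\mathtt f_\delta t}\,P(t)\Bigg)\,e^{N\mathtt f_\delta}.$$
   Context: For positive sequences, $a_n\sim b_n$ means $a_n/b_n\to1$. $\mathbb R^+=[0,\infty)$, $\mathbb N=\{1,2,\dots\}$. Model. $\mu$ is either Lebesgue measure on $\mathbb R$ (continuous set-up) or counting measure on $\mathbb Z$ (discrete set-up). $V:\mathbb R\to\mathbb R\cup\{+\infty\}$ satisfies $V(0)<\infty$ and $\kappa:=\int_{\mathbb R}e^{-V(y)}\mu(dy)<\infty$; in the continuous set-up $\exp(-V(\cdot))$ is continuous. Let $(Y_i)_{i\in\mathbb N}$ be IID with law $\mathbf P(Y_1\in dx)=\kappa^{-1}e^{-V(x)}\mu(dx)$, and $S_0=0$, $S_n=Y_1+\dots+Y_n$. Standing assumption (H): $\mathbf E[Y_1]=0$ and the truncated variance $\mathcal V(t):=\mathbf E[|Y_1|^2\mathbf 1_{\{|Y_1|\le t\}}]$ is slowly varying at infinity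 (a function $\ell$ is slowly varying if $\ell(ct)/\ell(t)\to1$ as $t\to\infty$ for each $c>0$). Partition functions. For $\varepsilon\ge0$, $N\in\mathbb N$, $a\in\{\mathrm f,\mathrm c\}$, $$Z^a_{\varepsilon,N}:=\int_{(\mathbb R^+)^N}e^{-H^a_N(x)}\prod_{i=1}^N\big(\mathbf 1_{(x_i>0)}\mu(dx_i)+\varepsilon\,\delta_0(dx_i)\big),$$ with $\delta_0$ the Dirac mass at $0$, $H^{\mathrm f}_N(x)=\sum_{i=0}^{N-1}V(x_{i+1}-x_i)$ with $x_0=0$, and $H^{\mathrm c}_N(x)=\sum_{i=0}^{N}V(x_{i+1}-x_i)$ with $x_0=x_{N+1}=0$. Set $Z^{\mathrm c}_{\varepsilon,0}:=e^{-V(0)}$. Define $\gamma:=\sum_{n\ge1}Z^{\mathrm c}_{0,n-1}/\kappa^n$, which is finite, and the probability distribution $q(n):=\gamma^{-1}Z^{\mathrm c}_{0,n-1}/\kappa^n$, $n\ge1$. Put $P(n):=\mathbf P(S_i>0,\ i=1,\dots,n)$, $P(0):=1$. Modified partition functions. For $\delta\ge 0$ and $N\ge1$, with $\varepsilon=\delta/\gamma$, $$\widetilde Z^{\mathrm c}_{\delta,N}:=\frac{(\delta/\gamma)\,Z^{\mathrm c}_{\delta/\gamma,N-1}}{\kappa^N},\qquad \widetilde Z^{\mathrm c}_{\delta,0}:=1,\qquad \widetilde Z^{\mathrm f}_{\delta,N}:=\frac{Z^{\mathrm f}_{\delta/\gamma,N}}{\kappa^N}.$$ *)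

(* Defs.v *)
From HB Require Import structures.
From mathcomp Require Import all_boot all_order all_algebra.
From mathcomp Require Import all_classical all_reals all_analysis.

Set Implicit Arguments.
Unset Strict Implicit.
Unset Printing Implicit Defensive.
Import Order.TTheory GRing.Theory Num.Theory.
Import numFieldNormedType.Exports.

Local Open Scope classical_set_scope.
Local Open Scope ring_scope.

(* The quotient is the one of \bar R, where a / +oo = 0 and a / 0 = a * +oo:
   it tends to 1 only if a n and b n are eventually finite and nonzero. *)
Definition asymp_equiv (R : realType) (a b : nat -> \bar R) : Prop :=
  (a n / b n)%E @[n --> \oo] --> 1%E.

Definition slowly_varying (R : realType) (l : R -> R) : Prop :=
  forall c : R, 0 < c -> l (c * t) / l t @[t --> +oo] --> (1 : R).

Definition mutually_independent (d : measure_display) (T : measurableType d)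
    (R : realType) (P : probability T R) (Y : nat -> {RV P >-> R}) : Prop :=
  forall (s : seq nat) (A : nat -> set R), uniq s ->
    (forall i, measurable (A i)) ->
    P (\bigcap_(i in [set` s]) (Y i @^-1` A i)) =
    (\prod_(i <- s) P (Y i @^-1` A i))%E.

Variant setup := ContinuousSetup | DiscreteSetup.

Lemma measurable_range_intr (R : realType) :
  measurable (range (intr : int -> R) : set (measurableTypeR R)).
Proof.
apply: countable_measurable => [x|]; first exact: measurable_set1.
exact: card_le_trans (card_image_le _ _) (countableP _).
Qed.

Definition base_measure (R : realType) (s : setup) :
    {measure set (measurableTypeR R) -> \bar R} :=
  match s with
  | ContinuousSetup => @lebesgue_measure R
  | DiscreteSetup => mrestr (@counting (measurableTypeR R) R) (@measurable_range_intr R)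
  end.

Definition kappa (R : realType) (s : setup) (V : R -> \bar R) : \bar R :=
  (\int[base_measure R s]_y expeR (- V y))%E.

Definition has_step_law (d : measure_display) (T : measurableType d)
    (R : realType) (P : probability T R) (s : setup) (V : R -> \bar R)
    (X : {RV P >-> R}) : Prop :=
  forall A : set R, measurable A ->
    (distribution P X A =
     (kappa s V)^-1 * \int[base_measure R s]_(x in A) expeR (- V x))%E.

Definition truncated_variance (d : measure_display) (T : measurableType d)
    (R : realType) (P : probability T R) (X : {RV P >-> R}) (t : R) : R :=
  fine 'E_P[fun w => `|X w| ^+ 2 * \1_[set w | `|X w| <= t] w].

(* [Y i] is the increment Y_{i+1}, so this is S_n = Y_1 + ... + Y_n. *)
Definition walk (d : measure_display) (T : measurableType d)
    (R : realType) (P : probability T R) (Y : nat -> {RV P >-> R})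
    (n : nat) (w : T) : R :=
  \sum_(i < n) Y i w.

Definition prob_positive (d : measure_display) (T : measurableType d)
    (R : realType) (P : probability T R) (Y : nat -> {RV P >-> R})
    (n : nat) : \bar R :=
  P [set w | forall i : nat, (1 <= i <= n)%N -> 0 < walk Y i w].

Local Open Scope ereal_scope.

(* 1_(x > 0) mu(dx) + eps delta_0(dx) *)
Definition site_measure (R : realType) (s : setup) (eps : {nonneg R}) :
    {measure set (measurableTypeR R) -> \bar R} :=
  measure_add
    (mrestr (base_measure R s) (measurable_itv `]0%R, +oo[%R))
    (mscale eps (@dirac _ (measurableTypeR R) 0%R R)).

(* Integral of [F] over D^n against the n-fold product of [nu], written as an
   iterated integral (Tonelli; it is only applied to nonnegative [F]). *)
Fixpoint iterated_integral (R : realType)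
    (nu : {measure set (measurableTypeR R) -> \bar R}) (D : set R) (n : nat) :
    (n.-tuple R -> \bar R) -> \bar R :=
  match n with
  | 0 => fun F => F [tuple]
  | m.+1 => fun F =>
      \int[nu]_(x in D)
        @iterated_integral R nu D m (fun t => F [tuple of x :: t])
  end.

(* (x_1, ..., x_N) extended by x_0 = 0 and x_{N+1} = 0 (the default value) *)
Definition height (R : realType) (N : nat) (x : N.-tuple R) (i : nat) : R :=
  nth 0%R (0%R :: x) i.

Definition Hf (R : realType) (V : R -> \bar R) (N : nat) (x : N.-tuple R) :
    \bar R :=
  \sum_(0 <= i < N) V (height x i.+1 - height x i)%R.

Definition Hc (R : realType) (V : R -> \bar R) (N : nat) (x : N.-tuple R) :
    \bar R :=
  \sum_(0 <= i < N.+1) V (height x i.+1 - height x i)%R.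

Definition Zf (R : realType) (s : setup) (V : R -> \bar R) (eps : {nonneg R})
    (N : nat) : \bar R :=
  @iterated_integral R (site_measure s eps) `[0%R, +oo[ N
    (fun x => expeR (- Hf V x)).

Definition Zc (R : realType) (s : setup) (V : R -> \bar R) (eps : {nonneg R})
    (N : nat) : \bar R :=
  @iterated_integral R (site_measure s eps) `[0%R, +oo[ N
    (fun x => expeR (- Hc V x)).

Definition gamma (R : realType) (s : setup) (V : R -> \bar R) : \bar R :=
  \sum_(1 <= n <oo) Zc s V (0%:nng)%R n.-1 / kappa s V ^+ n.

Definition q (R : realType) (s : setup) (V : R -> \bar R) (n : nat) : \bar R :=
  (gamma s V)^-1 * (Zc s V (0%:nng)%R n.-1 / kappa s V ^+ n).

Lemma iterated_integral_ge0 (R : realType)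
    (nu : {measure set (measurableTypeR R) -> \bar R}) (D : set R) (n : nat)
    (F : n.-tuple R -> \bar R) :
  (forall x, 0 <= F x) -> 0 <= iterated_integral nu D F.
Proof.
elim: n F => [|n IHn] F F0 /=; first exact: F0.
by apply: integral_ge0 => x _; apply: IHn => t; exact: F0.
Qed.

Lemma gamma_ge0 (R : realType) (s : setup) (V : R -> \bar R) :
  0 <= gamma s V.
Proof.
apply: nneseries_ge0 => n _ _; apply: mule_ge0.
  by apply: iterated_integral_ge0 => x; exact: expeR_ge0.
rewrite inve_ge0; apply: expe_ge0; apply: integral_ge0 => x _.
exact: expeR_ge0.
Qed.

(* epsilon = delta / gamma *)
Definition pinning (R : realType) (s : setup) (V : R -> \bar R)
    (delta : {nonneg R}) : {nonneg R} :=
  ((delta%:num / (NngNum (fine_ge0 (gamma_ge0 s V)))%:num)%:nng)%R.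

Definition Ztc (R : realType) (s : setup) (V : R -> \bar R)
    (delta : {nonneg R}) (N : nat) : \bar R :=
  match N with
  | 0 => 1
  | M.+1 => (pinning s V delta)%:num%:E * Zc s V (pinning s V delta) M
            / kappa s V ^+ M.+1
  end.

Definition Ztf (R : realType) (s : setup) (V : R -> \bar R)
    (delta : {nonneg R}) (N : nat) : \bar R :=
  Zf s V (pinning s V delta) N / kappa s V ^+ N.

Definition q_delta (R : realType) (s : setup) (V : R -> \bar R)
    (delta : {nonneg R}) (f : R) (t : nat) : \bar R :=
  delta%:num%:E * q s V t * (expR (- f * t%:R))%:E.

Definition mu_delta (R : realType) (s : setup) (V : R -> \bar R)
    (delta : {nonneg R}) (f : R) : \bar R :=
  \sum_(1 <= t <oo) t%:R%:E * q_delta s V delta f t.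

(* Main.v *)
From HB Require Import structures.
Require Import Defs.
From mathcomp Require Import all_boot all_order all_algebra.
From mathcomp Require Import all_classical all_reals all_analysis.
From mathcomp Require Import measurable_realfun ring lra zify.
Import Order.TTheory GRing.Theory Num.Theory.
Import numFieldNormedType.Exports.
Local Open Scope classical_set_scope.
Local Open Scope ring_scope.

(** Cutting a configuration at its zeros turns both partition functions into
    renewal sequences. Let [r] be the density of a step of the walk and let
    [A_eps] send [h] to the function whose value at [x] is the integral of
    [r (y - x) * h y] against [1_(y > 0) mu(dy) + eps delta_0(dy)]. Integrating
    the heights one after the other, [Zf N / kappa ^ N] is [A_eps ^ N 1] at [0]
    and [Zc N / kappa ^ N.+1] is [A_eps ^ N rt] at [0], where [rt x = r (- x)]
    is the density of a jump from [x] back to the wall ([ZfE], [ZcE]). As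
    [A_eps h = A_0 h + eps h(0) rt] is a rank-one perturbation of [A_0], its
    powers split according to the last visit to zero ([last_visit]). With
    [u = Ztc] and [z = Ztf] this reads
      [u (n+1) = sum_(j <= n) delta q(j+1) u (n-j)]  ([Ztc_renewal]),
      [z n = sum_(j <= n) P(j) u (n-j)]              ([Ztf_convolution]),
    where [A_0 ^ j 1] at [0] is the probability [P(j)] that the walk stays
    positive up to time [j] ([prob_positiveE]).

    Multiplied by [exp (- f n)], the first equation becomes a renewal equation
    with weights [q_delta], which sum to 1 by the choice of [f]. Their mean is
    finite since [q <= 1] and the tilt is exponential, and they are aperiodic
    since [q(1) > 0]. The renewal theorem ([renewal_cvg]) gives
    [u n * exp (- f n) --> 1 / mu_delta], and the convolution with the summable
    sequence [exp (- f j) P(j)] gives the limit of [z n * exp (- f n)]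
    ([cvg_convolution]).

    The renewal theorem has a short proof here because [b 0 > 0]. Let [L] be the
    limsup of the renewal sequence [v]. As [v (n+1)] is an average of previous
    values with weight [b 0] on [v n], if [v (n+1)] is close to [L] then so is
    [v n]; hence [v] has arbitrarily long stretches of values close to [L]. On
    such a stretch the identity [sum_i r_i v (n-i) = 1], where the tails [r_i]
    of [b] sum to the mean [mu], forces [L mu <= 1]. The same bound for [- v]
    says that the liminf is at least [1 / mu].

    That [A_0 ^ j 1] at [0] equals [P(j)] is the Markov property: by induction
    on [n], the event that the walk stays positive up to time [n] and ends in a
    given set is independent of the later steps ([walk_past_independent]), and
    the law of a step has density [r] ([step_lawE]).

    In the discrete set-up, [V] need not be measurable. The integral of a
    nonnegative function, measurable or not, depends only on its values on a set
    that carries the measure ([carrier_eq_integral]), so [exp (- V)] may be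
    replaced by its restriction to the integers, which is measurable. *)

(** * Discrete renewal theory *)

Lemma nondecreasing_cvgn_ub (R : realType) (u : nat -> R) (l : R) n :
  nondecreasing_seq u -> u @ \oo --> l -> u n <= l.
Proof.
move=> nd ul; rewrite -(cvg_lim _ ul)//; apply: nondecreasing_cvgn_le => //.
by apply/cvg_ex; exists l.
Qed.

Lemma cvgn_le_bound (R : realType) (u : nat -> R) (l m : R) :
  u @ \oo --> l -> (\forall n \near \oo, u n <= m) -> l <= m.
Proof. by move=> ul; exact: (ler_cvg_to ul (cvg_cst m)). Qed.

(** The weights are indexed so that [b k] is the weight of a gap of length
    [k + 1]. *)
Section renewal.
Context {R : realType} (b : nat -> R).
Hypothesis b_ge0 : forall k, 0 <= b k.
Hypothesis b0_gt0 : 0 < b 0%N.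
Hypothesis b_sum : series b @ \oo --> (1 : R).

Let r (i : nat) : R := 1 - \sum_(k < i) b k.

Lemma renewal_psum_le1 n : \sum_(k < n) b k <= 1.
Proof.
rewrite -(big_mkord xpredT).
have nd : nondecreasing_seq (series b).
  by apply/nondecreasing_seqP => m; rewrite /series/= big_nat_recr//= lerDl.
exact: (nondecreasing_cvgn_ub _ _ _ n nd b_sum).
Qed.

Lemma renewal_tail_ge0 i : 0 <= r i.
Proof. by rewrite subr_ge0 renewal_psum_le1. Qed.

Lemma renewal_tailS i : r i.+1 = r i - b i.
Proof. by rewrite /r big_ord_recr/= opprD addrA. Qed.

Lemma renewal_tail_small (e : R) : 0 < e -> exists K, forall n, (K <= n)%N -> r n <= e.
Proof.
move=> e0; have /cvgrPdist_le/(_ _ e0)[K _ HK] := b_sum.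
exists K => n /HK /=; rewrite /series/= big_mkord.
by rewrite ger0_norm// renewal_tail_ge0.
Qed.

Section limsup.
Context (w : nat -> R) (c mu : R).
Hypothesis w_le1 : forall n, `|w n| <= 1.
Hypothesis w_rec : forall n, w n.+1 = \sum_(k < n.+1) b k * w (n - k)%N.
Hypothesis w_tail : forall n, \sum_(i < n.+1) r i * w (n - i)%N = c.
Hypothesis r_sum : (fun n => \sum_(i < n) r i) @ \oo --> mu.

Let E := [set M | \forall n \near \oo, w n <= M].
Let L := inf E.

Let E1 : E 1.
Proof. by apply: nearW => n; exact: le_trans (ler_norm _) (w_le1 n). Qed.

Let E_lb : lbound E (-1).
Proof.
move=> M [n _ /(_ n (leqnn n))/=]; apply: le_trans.
by have := w_le1 n; rewrite ler_norml => /andP[].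
Qed.

Let E_inf : has_inf E.
Proof. by split; [exists 1|exists (-1)]. Qed.

Let L_bounds : -1 <= L <= 1.
Proof.
apply/andP; split; last by apply: ge_inf => //; exists (-1).
by apply: lb_le_inf => //; exists 1.
Qed.

Let L_up (e : R) : 0 < e -> exists n0, forall n, (n0 <= n)%N -> w n <= L + e.
Proof.
move=> e0; have [M [n0 _ EM] ML] := inf_adherent e0 E_inf.
by exists n0 => n /EM /= /le_trans; apply; exact: ltW.
Qed.

Let L_freq (e : R) n0 : 0 < e -> exists2 n, (n0 <= n)%N & L - e < w n.
Proof.
move=> e0; apply: contrapT => H.
have : E (L - e).
  exists n0 => // n /= n0n; rewrite leNgt; apply/negP => Lw; apply: H.
  by exists n.
by move=> /(ge_inf (ex_intro _ _ E_lb)); rewrite -/L; lra.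
Qed.

(** Since [w n.+1 - L] is, up to a tail, an average of the [w (n - k) - L] and
    each of these is at most slightly positive, the term of weight [b 0] cannot
    be very negative. *)
Let limsup_step_back (e : R) : 0 < e -> exists2 t, 0 < t &
  exists n0, forall n, (n0 <= n)%N -> L - t < w n.+1 -> L - e < w n.
Proof.
move=> e0.
(* Beyond the term of index [0], the errors add up to at most [4 t], and [w n.+1]
   itself is within [t] of [L]: together [5 t]. *)
have [t t0 tE] : exists2 t, 0 < t & b 0%N * e = 5 * t.
  by exists (b 0%N * e / 5); [rewrite divr_gt0// mulr_gt0|field].
exists t => //.
have [n1 Hn1] := L_up _ t0; have [K HK] := renewal_tail_small _ t0.
exists (n1 + K)%N => n nK.
have wE : w n.+1 - L = \sum_(k < n.+1) b k * (w (n - k)%N - L) - L * r n.+1.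
  under eq_bigr do rewrite mulrBr.
  by rewrite sumrB -w_rec -mulr_suml /r; ring.
have Lr : - (L * r n.+1) <= t.
  have := HK n.+1 (leqW (leq_trans (leq_addl _ _) nK)).
  have := renewal_tail_ge0 n.+1; have /andP[] := L_bounds; nra.
have bk k : (w (n - k)%N - L) <= t + 2 * (K <= k)%:R.
  case: (leqP K k) => Kk /=; last first.
    rewrite mulr0 addr0 lerBlDl Hn1//.
    rewrite leq_subRL; last by rewrite (leq_trans (ltnW Kk))// (leq_trans (leq_addl n1 K)).
    by apply: leq_trans nK; rewrite addnC leq_add2l ltnW.
  have := w_le1 (n - k); rewrite ler_norml => /andP[_]; have /andP[] := L_bounds; lra.
have sumle : \sum_(k < n) b k.+1 * (w (n - k.+1)%N - L) <= 3 * t.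
  apply: (@le_trans _ _ (\sum_(k < n.+1) b k * (t + 2 * (K <= k)%:R))).
    rewrite [leRHS]big_ord_recl/= -[leLHS]add0r; apply: lerD.
      by rewrite mulr_ge0// addr_ge0// ?ltW// mulr_ge0.
    by apply: ler_sum => k _; rewrite ler_wpM2l.
  under eq_bigr do rewrite mulrDr mulrCA.
  rewrite big_split/= -mulr_suml -mulr_sumr.
  have -> : \sum_(k < n.+1) b k * (K <= k)%:R = r K - r n.+1.
    have -> : r K - r n.+1 = \sum_(k < n.+1) b k - \sum_(k < K) b k.
      by rewrite /r; ring.
    have Kn : (K <= n.+1)%N by rewrite (leq_trans _ (leqW nK))// leq_addl.
    rewrite -(big_mkord xpredT (fun k => b k * (K <= k)%:R)) -!(big_mkord xpredT b).
    rewrite !(big_cat_nat (leq0n _) Kn)//= [X in X + _]big_nat_cond big1 => [|k].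
      rewrite add0r addrAC subrr add0r.
      by apply: eq_big_nat => k /andP[-> _]; rewrite mulr1.
    by rewrite andbT => /andP[_ kK]; rewrite leqNgt kK mulr0.
  have := HK K (leqnn K); have := renewal_tail_ge0 n.+1; have := renewal_psum_le1 n.+1.
  by nra.
rewrite -[_ < w n.+1](ltrD2r (- L)) wE big_ord_recl subn0 => H.
have : - (b 0%N * e) < b 0%N * (w n - L).
  by move: H sumle Lr; rewrite /bump/=;
     rewrite tE; lra.
by rewrite -mulrN ltr_pM2l//; lra.
Qed.

Let limsup_back i (e : R) : 0 < e -> exists2 t, 0 < t &
  exists n0, forall n, (n0 <= n)%N -> L - t < w (n + i)%N -> L - e < w n.
Proof.
elim: i => [e0|i IH e0]; first by exists e => //; exists 0%N => n _; rewrite addn0.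
have [t t0 [n0 Hn0]] := IH e0; have [t' t'0 [n1 Hn1]] := limsup_step_back _ t0.
exists t' => //; exists (n0 + n1)%N => n nn; rewrite addnS => H.
apply: Hn0; first by rewrite (leq_trans _ nn)// leq_addr.
by apply: Hn1 => //; rewrite (leq_trans _ (leq_trans nn (leq_addr _ _)))// leq_addl.
Qed.

Let limsup_stretch M (e : R) : 0 < e -> exists2 t, 0 < t &
  exists n0, forall n, (n0 <= n)%N -> L - t < w n ->
    forall i, (i < M)%N -> L - e < w (n - i)%N.
Proof.
move=> e0; elim: M => [|M [t t0 [n0 H]]]; first by exists 1 => //; exists 0%N.
have [t' t'0 [n1 Hn1]] := limsup_back M _ e0.
exists (Num.min t t'); first by rewrite lt_min t0.
exists (n0 + (n1 + M))%N => n nn Lw i; rewrite ltnS leq_eqVlt => /predU1P[->|iM].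
  apply: Hn1; first by rewrite leq_subRL; [lia|lia].
  rewrite subnK; last lia.
  by apply: le_lt_trans Lw; rewrite lerD2l lerN2 ge_min lexx orbT.
apply: H => //; first lia.
by apply: le_lt_trans Lw; rewrite lerD2l lerN2 ge_min lexx.
Qed.

Let psum_tail_le n : \sum_(i < n) r i <= mu.
Proof.
have nd : nondecreasing_seq (fun n => \sum_(i < n) r i).
  by apply/nondecreasing_seqP => m; rewrite big_ord_recr/= lerDl renewal_tail_ge0.
exact: (nondecreasing_cvgn_ub _ _ _ n nd r_sum).
Qed.

(** On a stretch of length [M] ending at [n], the first [M] terms of the
    identity [w_tail] contribute at least [(L - e) sum_(i < M) r i], and the
    others at least minus the remaining mass of [r], because [w >= - 1]. *)
Let Lmu : L * mu <= c.
Proof.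
have key M e : 0 < e -> (L - e) * (\sum_(i < M) r i) - (mu - \sum_(i < M) r i) <= c.
  move=> e0; have [t t0 [n0 H]] := limsup_stretch M _ e0.
  have [n nn Lw] := L_freq _ (n0 + M)%N t0.
  have nM : (M <= n.+1)%N by lia.
  rewrite -(w_tail n) -!(big_mkord xpredT (fun i => r i * w (n - i)%N)) -!(big_mkord xpredT r) (big_cat_nat (leq0n _) nM)//=; apply: lerD.
    rewrite mulr_sumr; apply: ler_sum_nat => i /andP[_ iM].
    by rewrite mulrC ler_wpM2l ?renewal_tail_ge0// ltW// H//; lia.
  have := psum_tail_le n.+1; rewrite -(big_mkord xpredT r) (big_cat_nat (leq0n _) nM)//=.
  move=> Hmu; apply: (@le_trans _ _ (- \sum_(M <= i < n.+1) r i)); first lra.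
  rewrite -sumrN; apply: ler_sum_nat => i _.
  by have := w_le1 (n - i)%N; rewrite ler_norml => /andP[+ _]; have := renewal_tail_ge0 i; nra.
have key0 M : L * (\sum_(i < M) r i) - (mu - \sum_(i < M) r i) <= c.
  apply/ler_addgt0Pr => e e0.
  set S := \sum_(i < M) r i.
  have S0 : 0 <= S by apply: sumr_ge0 => i _; exact: renewal_tail_ge0.
  have S1 : 0 < S + 1 by lra.
  have := key M (e / (S + 1)) (divr_gt0 e0 S1); rewrite -/S.
  have : e / (S + 1) * S <= e.
    by rewrite mulrAC ler_pdivrMr//; nra.
  lra.
have : (fun M => L * (\sum_(i < M) r i) - (mu - \sum_(i < M) r i)) @ \oo --> L * mu - (mu - mu).
  apply: cvgB; first by apply: cvgM => //; exact: cvg_cst.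
  by apply: cvgB => //; exact: cvg_cst.
rewrite subrr subr0 => cv.
by apply: (cvgn_le_bound _ _ _ _ cv); exact: nearW.
Qed.

(** The statement allows any value [c] in the tail identity because it serves
    for the renewal sequence, with [c = 1], and for its opposite, with
    [c = - 1]. *)
Lemma renewal_limsup (e : R) : 0 < mu -> 0 < e ->
  \forall n \near \oo, w n <= c / mu + e.
Proof.
move=> mu0 e0; have [n0 H] := L_up _ e0.
exists n0 => // n /= /H /le_trans; apply; rewrite lerD2r ler_pdivlMr//; exact: Lmu.
Qed.

End limsup.

Context (v : nat -> R).
Hypothesis v0 : v 0%N = 1.
Hypothesis v_rec : forall n, v n.+1 = \sum_(k < n.+1) b k * v (n - k)%N.

Lemma renewal_ge0 n : 0 <= v n.
Proof.
elim/ltn_ind: n => -[|n] IH; first by rewrite v0.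
rewrite v_rec; apply: sumr_ge0 => k _; rewrite mulr_ge0// IH//.
by rewrite ltnS leq_subr.
Qed.

Lemma renewal_le1 n : v n <= 1.
Proof.
elim/ltn_ind: n => -[|n] IH; first by rewrite v0.
rewrite v_rec; apply: le_trans (renewal_psum_le1 n.+1); apply: ler_sum => k _.
by rewrite ler_piMr// IH// ltnS leq_subr.
Qed.

(** Some renewal at or before time [n] is the last one; [r i] is the probability
    that the gap after it exceeds [i]. Algebraically, consecutive left-hand
    sides differ by the renewal equation. *)
Lemma renewal_tail_identity n : \sum_(i < n.+1) r i * v (n - i)%N = 1.
Proof.
elim: n => [|n IH].
  by rewrite big_ord_recl big_ord0 /r big_ord0 subr0 addr0 mul1r v0.
rewrite big_ord_recl subn0 {1}/r big_ord0 subr0 mul1r v_rec.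
rewrite -[RHS]IH -big_split/=; apply: eq_bigr => i _.
by rewrite /bump/= add1n subSS renewal_tailS; ring.
Qed.

(** The renewal theorem of Erdos, Feller and Pollard, when a gap of length one
    has positive weight. *)
Lemma renewal_cvg (mu : R) : series (fun k => k.+1%:R * b k) @ \oo --> mu ->
  v @ \oo --> mu^-1.
Proof.
move=> b_mean.
have nd : nondecreasing_seq (series (fun k => k.+1%:R * b k)).
  by apply/nondecreasing_seqP => m; rewrite /series/= big_nat_recr//= lerDl mulr_ge0.
have mean_le n : \sum_(k < n) k.+1%:R * b k <= mu.
  rewrite -(big_mkord xpredT (fun k => k.+1%:R * b k)).
  exact: (nondecreasing_cvgn_ub _ _ _ n nd b_mean).
have mu_gt0 : 0 < mu.
  have := mean_le 1%N; rewrite big_ord_recl big_ord0 addr0 mul1r.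
  exact: lt_le_trans.
(* Summation by parts: the tails of [b] sum to its mean, as [n r n] is dominated
   by the tail of the series of the mean. *)
have sum_tail n : \sum_(i < n) r i = \sum_(k < n) k.+1%:R * b k + n%:R * r n.
  elim: n => [|n IH]; first by rewrite !big_ord0 mul0r addr0.
  by rewrite !big_ord_recr/= IH renewal_tailS -natr1; ring.
have ntail n : n%:R * r n <= mu - \sum_(k < n) k.+1%:R * b k.
  have cv : (fun m => n%:R * (series b m - \sum_(k < n) b k)) @ \oo --> n%:R * r n.
    by apply: cvgM; [exact: cvg_cst|apply: cvgB => //; exact: cvg_cst].
  apply: (cvgn_le_bound _ _ _ _ cv); exists n => // m /= nm.
  have split (g : nat -> R) :
      \sum_(k < m) g k - \sum_(k < n) g k = \sum_(n <= k < m) g k.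
    rewrite -!(big_mkord xpredT g) (big_cat_nat (leq0n _) nm)//=.
    by rewrite addrAC subrr add0r.
  rewrite /series/= big_mkord split.
  apply: (@le_trans _ _ (\sum_(n <= i < m) i.+1%:R * b i)); last first.
    by rewrite -split lerD2r mean_le.
  rewrite mulr_sumr; apply: ler_sum_nat => i /andP[ni _].
  by rewrite ler_wpM2r// ler_nat ltnW.
have r_sum : (fun n => \sum_(i < n) r i) @ \oo --> mu.
  have cv : (fun n => \sum_(k < n) k.+1%:R * b k) @ \oo --> mu.
    rewrite (_ : (fun n => _) = series (fun k => k.+1%:R * b k))//.
    by apply/funext => n; rewrite /series/= big_mkord.
  apply: (squeeze_cvgr _ cv (cvg_cst mu)); apply: nearW => n.
  rewrite sum_tail; have := ntail n.
  have : 0 <= n%:R * r n by rewrite mulr_ge0// renewal_tail_ge0.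
  by move=> ? ?; apply/andP; split; lra.
have vnorm n : `|v n| <= 1 by rewrite ger0_norm ?renewal_ge0 ?renewal_le1.
have up := renewal_limsup v 1 mu vnorm v_rec renewal_tail_identity r_sum.
have lo : forall e : R, 0 < mu -> 0 < e -> \forall n \near \oo, - v n <= (-1) / mu + e.
  apply: (renewal_limsup (fun n => - v n)) => // n.
  - by rewrite normrN.
  - by rewrite v_rec -sumrN; apply: eq_bigr => k _; rewrite mulrN.
  - by under eq_bigr do rewrite mulrN; rewrite sumrN renewal_tail_identity.
apply/cvgrPdist_le => e e0; near=> n.
have H1 : v n <= 1 / mu + e by near: n; exact: up.
have H2 : - v n <= -1 / mu + e by near: n; exact: lo.
by rewrite ler_distlC; move: H1 H2; rewrite mulNr div1r => ? ?; apply/andP; split; lra.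
Unshelve. all: by end_near. Qed.

End renewal.

Lemma cvg_convolution (R : realType) (v p : nat -> R) (l s : R) :
  (forall n, `|v n| <= 1) -> (forall n, 0 <= p n) ->
  v @ \oo --> l -> series p @ \oo --> s ->
  (fun n => \sum_(k < n.+1) v (n - k)%N * p k) @ \oo --> l * s.
Proof.
move=> v1 p0 vl ps.
have l1 : `|l| <= 1.
  by apply: (cvgn_le_bound _ _ _ _ (cvg_norm vl)); exact: nearW.
have nd : nondecreasing_seq (series p).
  by apply/nondecreasing_seqP => m; rewrite /series/= big_nat_recr//= lerDl.
have ps_le n : series p n <= s.
  exact: (nondecreasing_cvgn_ub _ _ _ n nd ps).
have s0 : 0 <= s by have := ps_le 0%N; rewrite /series/= big_geq.
apply/cvgrPdist_le => e e0.
pose t := e / (s + 3); have t0 : 0 < t by rewrite divr_gt0//; lra.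
have /cvgrPdist_le/(_ _ t0)[K _ HK] := ps.
have /cvgrPdist_le/(_ _ t0)[N _ HN] := vl.
exists (K + N)%N => // n /= nKN.
have -> : l * s - \sum_(k < n.+1) v (n - k)%N * p k =
    l * (s - series p n.+1) + \sum_(k < n.+1) (l - v (n - k)%N) * p k.
  rewrite /series/= big_mkord.
  under [in RHS]eq_bigr do rewrite mulrBl.
  by rewrite sumrB -mulr_sumr; ring.
have h1 : `|l * (s - series p n.+1)| <= t.
  rewrite normrM -[t]mul1r ler_pM// HK//=; lia.
have h2 : `|\sum_(k < n.+1) (l - v (n - k)%N) * p k| <= t * s + 2 * t.
  apply: le_trans (ler_norm_sum _ _ _) _.
  have Kn : (K <= n.+1)%N by lia.
  rewrite -(big_mkord xpredT (fun k => `|(l - v (n - k)%N) * p k|)) (big_cat_nat (leq0n _) Kn)//=.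
  apply: lerD.
    apply: (@le_trans _ _ (t * series p K)); last by rewrite ler_wpM2l// ltW.
    rewrite /series/= mulr_sumr; apply: ler_sum_nat => k /andP[_ kK].
    by rewrite normrM (ger0_norm (p0 _)) ler_wpM2r// HN//=; lia.
  apply: (@le_trans _ _ (2 * (series p n.+1 - series p K))).
    rewrite /series/= (big_cat_nat (leq0n _) Kn)//= addrAC subrr add0r mulr_sumr.
    apply: ler_sum_nat => k _; rewrite normrM (ger0_norm (p0 _)) ler_wpM2r//.
    by rewrite (le_trans (ler_normB _ _))//; have := v1 (n - k)%N; lra.
  rewrite ler_wpM2l//; have := HK K (leqnn K) => /= /(le_trans (ler_norm _)).
  by have := ps_le n.+1; lra.
rewrite (le_trans (ler_normD _ _))// (le_trans (lerD h1 h2))//.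
have : t * (s + 3) = e by rewrite /t; field; lra.
lra.
Qed.

(** * Carriers of measures and the base measure *)

Section carrier.
Context d (T : measurableType d) (R : realType).
Variable m : {measure set T -> \bar R}.
Local Open Scope ereal_scope.
Import HBSimple HBNNSimple.

(** The integral of a nonnegative function is a supremum over simple functions
    below it, and a simple function can be multiplied by the indicator of the
    carrier [S] without changing its integral; this is why [F] and [G] may fail
    to be measurable. *)
Lemma carrier_eq_integral (S D : set T) (F G : T -> \bar R) :
  measurable S -> (forall A, measurable A -> m A = m (A `&` S)) ->
  (forall x, D x -> 0 <= F x) -> (forall x, D x -> 0 <= G x) ->
  (forall x, D x -> S x -> F x = G x) ->
  \int[m]_(x in D) F x = \int[m]_(x in D) G x.
Proof.
move=> mS mAS.
have half F' G' : (forall x, D x -> 0 <= F' x) -> (forall x, D x -> 0 <= G' x) ->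
    (forall x, D x -> S x -> F' x = G' x) ->
    \int[m]_(x in D) F' x <= \int[m]_(x in D) G' x.
  move=> F0 G0 FG; rewrite !ge0_integralE//.
  apply: ge_ereal_sup => _ [h /= hF <-].
  rewrite (_ : sintegral m h = sintegral m (proj_nnsfun h mS)).
    apply: ereal_sup_ubound; exists (proj_nnsfun h mS) => //= x.
    have := hF x; rewrite /patch; case: ifPn => [/set_mem Dx|_].
      rewrite mindicE; case: (boolP (x \in S)) => xS; last by rewrite mulr0 G0.
      by rewrite mulr1 FG//; exact: set_mem.
    rewrite lee_fin => h0; rewrite lee_fin.
    by rewrite mulr_le0_ge0// ?fun_ge0.
  rewrite -!integralT_nnsfun.
  apply: ge0_ae_eq_integral => //.
  - exact/measurable_EFinP.
  - exact/measurable_EFinP.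
  - by move=> x _; rewrite lee_fin.
  - by move=> x _; rewrite lee_fin.
  exists (~` S); split; first exact: measurableC.
    by rewrite mAS ?setICl ?measure0//; exact: measurableC.
  move=> x /= H Sx; apply: H => _; congr (_ %:E).
  by rewrite /= mindicE mem_set// mulr1.
move=> F0 G0 FG; apply/eqP; rewrite eq_le !half// => x Dx Sx.
by rewrite FG.
Qed.

End carrier.

Section mrestr.
Context d (T : measurableType d) (R : realType).
Variable m : {measure set T -> \bar R}.
Local Open Scope ereal_scope.

(** Both sides ignore the values of [F] outside [E]. *)
Lemma integral_mrestr (E D : set T) (mE : measurable E) (F : T -> \bar R) :
  (forall x, D x -> 0 <= F x) ->
  \int[mrestr m mE]_(x in D) F x = \int[m]_(x in D `&` E) F x.
Proof.
move=> F0; transitivity (\int[mrestr m mE]_(x in D) (F \_ E) x).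
  apply: (@carrier_eq_integral _ _ _ _ E) => //.
  - by move=> A mA; rewrite /= /mrestr -setIA setIid.
  - by move=> x Dx; rewrite /patch; case: ifPn => // _; exact: F0.
  - by move=> x Dx Ex; rewrite /patch mem_set.
rewrite -integral_mkcondr; apply: eq_measure_integral => A mA AD.
by rewrite /= /mrestr setIidl// => x /AD[].
Qed.

End mrestr.

Lemma counting_image (R : realType) (T T' : choiceType) (g : T -> T') (A : set T) :
  injective g -> counting (g @` A) = counting A :> \bar R.
Proof.
move=> gi; have [fin|inf] := pselect (finite_set A).
  have fing := finite_image g fin.
  rewrite /counting (asboolT fin) (asboolT fing) fset_set_image//.
  by rewrite finmap.card_imfset.
rewrite /counting !asboolF// => fin; apply: inf.
apply: (sub_finite_set _ (finite_preimage (f := g) _ fin)) => //.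
  by move=> y yC; exists y.
by move=> u v _ _ /gi.
Qed.

Definition base_support (R : realType) (s : setup) : set R :=
  if s is ContinuousSetup then setT else range (intr : int -> R).

Section base_measure.
Context {R : realType} (s : setup).
Local Notation mu := (base_measure R s).
Local Notation supp := (@base_support R s).
Local Open Scope ereal_scope.

Lemma measurable_base_support : measurable (supp : set (measurableTypeR R)).
Proof. by rewrite /base_support; case: s => //; exact: measurable_range_intr. Qed.

Lemma base_support0 : supp 0%R.
Proof. by rewrite /base_support; case: s => //; exists 0%R. Qed.

Lemma base_supportB x y : supp x -> supp y -> supp (x - y)%R.
Proof.
rewrite /base_support; case: s => // -[a _ <-] [b _ <-].
by exists (a - b)%R => //; rewrite intrB.
Qed.

Lemma base_supportD x y : supp x -> supp y -> supp (x + y)%R.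
Proof.
move=> Sx Sy; rewrite -[y]opprK; apply: base_supportB => //.
by rewrite -[(- y)%R]sub0r; apply: base_supportB => //; exact: base_support0.
Qed.

Lemma base_measure_support A : measurable A -> mu A = mu (A `&` supp).
Proof.
rewrite /base_support /base_measure; case: s => mA; first by rewrite setIT.
by rewrite /= /mrestr -setIA setIid.
Qed.

(** In the discrete set-up, the real line is covered by the sets made of all
    non-integers together with one integer. *)
Lemma sigma_finite_base_measure : sigma_finite setT mu.
Proof.
rewrite /base_measure; case: s => /=.
  exact: sigma_finiteT.
pose F (n : nat) : set R := ~` (range intr) `|`
  [set x | exists2 z : int, unpickle n = Some z & x = z%:~R].
have mF n : measurable (F n : set (measurableTypeR R)).
  apply: measurableU; first exact: (measurableC (@measurable_range_intr R)).
  apply: countable_measurable; first by move=> x; exact: measurable_set1.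
  case E : (unpickle n) => [z|].
    apply: finite_set_countable; apply: (sub_finite_set _ (finite_set1 (z%:~R : R))).
    by move=> x [z' [->] ->].
  by apply: finite_set_countable; apply: (sub_finite_set _ (finite_set0 R)) => x [z' []].
exists F.
  apply/esym; rewrite -subTset => x _; have [[z _ zx]|nx] := pselect (range intr x).
    by exists (pickle z) => //; right; exists z; rewrite ?pickleK.
  by exists 0%N => //; left.
move=> n; split => //; rewrite /mrestr.
rewrite (_ : F n `&` _ = [set x | exists2 z : int, unpickle n = Some z & x = z%:~R]).
  rewrite /counting asboolT ?ltry//.
  case E : (unpickle n) => [z|].
    by apply: (sub_finite_set _ (finite_set1 (z%:~R : R))) => x [z' [->] ->].
  by apply: (sub_finite_set _ (finite_set0 R)) => x [z' []].
apply/seteqP; split => [x [[nx /nx//|//]]|x [z zn ->]].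
by split; [right; exists z|exists z].
Qed.

Lemma base_measure_translation (x : R) A : supp x -> measurable A ->
  mu ((fun y => (x + y)%R) @^-1` A) = mu A.
Proof.
rewrite /base_support /base_measure; case: s => /= [_|[a _ <-]] mA.
  have mD : measurable_fun [set: measurableTypeR R]
    ((fun y => x + y)%R : _ -> measurableTypeR R).
    exact: measurable_funD.
  pose f : {mfun (measurableTypeR R) >-> (measurableTypeR R)} :=
     HB.pack ((fun y => x + y)%R : _ -> measurableTypeR R)
       (isMeasurableFun.Build _ _ _ _ _ mD).
  rewrite -[LHS]/(pushforward lebesgue_measure f A).
  apply/esym/lebesgue_measure_unique => //= _ [[c e]] _ <-.
  rewrite /pushforward/= (_ : _ @^-1` _ = `](c - x)%R, (e - x)%R]%classic); last first.
    apply/seteqP; split => y /=; rewrite !in_itv/=; lra.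
  rewrite !lebesgue_measure_itv/= !lte_fin ltrD2r.
  by case: ifPn => // _; rewrite -!EFinB; congr (_ %:E); ring.
rewrite /mrestr /counting.
pose g (y : R) := (a%:~R + y)%R.
have gi : injective g by move=> u v /addrI.
have E : A `&` range intr = g @` (g @^-1` A `&` range intr).
  apply/seteqP; split => [y [Ay [z _ zy]]|_ [y [Ay [z _ zy]] <-]].
    have gz : g (z - a)%:~R = y by rewrite -zy /g rmorphB/= addrCA subrr addr0.
    exists ((z - a)%:~R : R)%R => //; split; last by exists (z - a)%R.
    by rewrite /= gz.
  by split => //; exists (a + z)%R => //; rewrite /g rmorphD/= zy.
by rewrite E; apply/esym/counting_image.
Qed.

End base_measure.

(** * The one-step operator and the last visit to zero *)

Section site.
Context {R : realType} (s : setup).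
Local Notation mu := (base_measure R s).
Local Notation supp := (@base_support R s).
Local Open Scope ereal_scope.

Lemma site_measureE (eps : {nonneg R}) A : site_measure s eps A =
  mu (A `&` `]0%R, +oo[) + eps%:num%:E * dirac (0%R : measurableTypeR R) A.
Proof. exact: measure_addE. Qed.

Lemma site_measure_support (eps : {nonneg R}) A : measurable A ->
  site_measure s eps A = site_measure s eps (A `&` supp).
Proof.
move=> mA; rewrite !site_measureE; congr (_ + _ * _).
  rewrite [LHS]base_measure_support; first by rewrite setIAC.
  by apply: measurableI => //; exact: measurable_itv.
rewrite /dirac !indicE; congr ((nat_of_bool _)%:R%:E); apply/idP/idP.
  by rewrite !inE => A0; split => //; exact: base_support0.
by rewrite !inE => -[].
Qed.

Lemma site_integralE (eps : {nonneg R}) (F : R -> \bar R) :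
  (forall x, 0 <= F x) -> measurable_fun [set: measurableTypeR R] F ->
  \int[site_measure s eps]_(y in `[0%R, +oo[) F y =
  \int[mu]_(y in `]0%R, +oo[) F y + eps%:num%:E * F 0%R.
Proof.
move=> F0 mF; have mD : measurable (`[0%R, +oo[ : set (measurableTypeR R)).
  exact: measurable_itv.
have mFD D := @measurable_funTS _ _ _ _ D _ mF.
rewrite /site_measure ge0_integral_measure_add//.
rewrite integral_mrestr// ge0_integral_mscale//.
rewrite integral_dirac//.
congr (_ + _ * _).
  congr (integral _ _ _); apply/seteqP; split => y /=; rewrite !in_itv/= ?andbT.
    by case.
  by move=> y0; split => //; exact: ltW.
by rewrite diracE mem_set ?mul1e//= in_itv/= lexx.
Qed.

Lemma measurable_integral_base (F : R * R -> \bar R) :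
  (forall x, 0 <= F x) ->
  measurable_fun [set: measurableTypeR R * measurableTypeR R] F ->
  measurable_fun [set: measurableTypeR R] (fun x => \int[mu]_y F (x, y)).
Proof.
move=> F0 mF.
pose nu : {sigma_finite_measure set (measurableTypeR R) -> \bar R} :=
  HB.pack (Measure.sort mu)
    (isSFinite.Build _ _ _ _ (sfinite_measure_sigma_finite (@sigma_finite_base_measure R s)))
    (isSigmaFinite.Build _ _ _ _ (@sigma_finite_base_measure R s)).
exact: (measurable_fun_fubini_tonelli_F (m2 := nu) F).
Qed.

Context (r : R -> R).
Hypothesis r_ge0 : forall x, (0 <= r x)%R.
Hypothesis mr : measurable_fun [set: measurableTypeR R] (r : _ -> measurableTypeR R).

(** One site of the polymer: [x] is the height before it, and [h] is the weight
    of the rest of the configuration as a function of the height at it. *)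
Definition site_op (eps : {nonneg R}) (h : R -> \bar R) (x : R) : \bar R :=
  \int[site_measure s eps]_(y in `[0%R, +oo[) ((r (y - x))%:E * h y).

(** The density, at height [x], of a step that ends at the wall. *)
Definition return_kernel (x : R) : \bar R := (r (- x))%:E.

Lemma measurable_return_kernel : measurable_fun [set: measurableTypeR R] return_kernel.
Proof. by apply/measurable_EFinP; apply: measurableT_comp mr _; exact: measurable_funN. Qed.

Lemma return_kernel_ge0 x : 0 <= return_kernel x.
Proof. by rewrite lee_fin. Qed.

Section one_step.
Variables (eps : {nonneg R}) (h : R -> \bar R).
Hypothesis h0 : forall x, 0 <= h x.
Hypothesis mh : measurable_fun [set: measurableTypeR R] h.

Lemma measurable_step x :
  measurable_fun [set: measurableTypeR R] (fun y => (r (y - x))%:E * h y).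
Proof.
apply: emeasurable_funM => //; apply/measurable_EFinP.
by apply: measurableT_comp mr _; exact: measurable_funB.
Qed.

Lemma site_op_ge0 x : 0 <= site_op eps h x.
Proof. by apply: integral_ge0 => y _; rewrite mule_ge0// lee_fin. Qed.

Lemma site_opE x : site_op eps h x =
  \int[mu]_(y in `]0%R, +oo[) ((r (y - x))%:E * h y)
  + eps%:num%:E * (return_kernel x * h 0%R).
Proof.
rewrite /site_op site_integralE ?sub0r//; last exact: measurable_step.
by move=> y; rewrite mule_ge0// lee_fin.
Qed.

Lemma measurable_site_op : measurable_fun [set: measurableTypeR R] (site_op eps h).
Proof.
rewrite (_ : site_op eps h = fun x =>
  \int[mu]_y (((r (y - x))%:E * h y) * (\1_`]0%R, +oo[ y)%:E)
  + eps%:num%:E * (return_kernel x * h 0%R)); last first.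
  apply/funext => x; rewrite site_opE integral_mkcond; congr (_ + _).
  by apply: eq_integral => y _; rewrite epatch_indic.
apply: emeasurable_funD; last first.
  apply: emeasurable_funM => //; apply: emeasurable_funM => //.
  exact: measurable_return_kernel.
pose F (z : R * R) := (r (z.2 - z.1))%:E * h z.2 * (\1_`]0%R, +oo[ z.2)%:E.
apply: (@measurable_integral_base F).
  by move=> z; rewrite mule_ge0// ?mule_ge0// lee_fin.
apply: emeasurable_funM; first apply: emeasurable_funM.
- apply/measurable_EFinP; apply: measurableT_comp mr _.
  by apply: measurable_funB; [exact: measurable_snd|exact: measurable_fst].
- by apply: measurableT_comp mh _; exact: measurable_snd.
- apply/measurable_EFinP.
  apply: (@measurableT_comp _ _ _ _ _ _ (\1_`]0%R, +oo[ : measurableTypeR R -> measurableTypeR R)).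
    by apply: measurable_indic; exact: measurable_itv.
  exact: measurable_snd.
Qed.

Lemma site_opZ (c : \bar R) x : 0 <= c ->
  site_op eps (fun y => c * h y) x = c * site_op eps h x.
Proof.
move=> c0; rewrite /site_op -ge0_integralZl//.
- by apply: eq_integral => y _; rewrite muleCA.
- exact: measurable_funTS (measurable_step x).
- by move=> y _; rewrite mule_ge0// lee_fin.
Qed.

Lemma site_opD h' x : (forall y, 0 <= h' y) ->
  measurable_fun [set: measurableTypeR R] h' ->
  site_op eps (fun y => h y + h' y) x = site_op eps h x + site_op eps h' x.
Proof.
move=> h'0 mh'; rewrite /site_op -ge0_integralD//.
- by apply: eq_integral => y _; rewrite ge0_muleDr.
- by move=> y _; rewrite mule_ge0// lee_fin.
- exact: measurable_funTS (measurable_step x).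
- by move=> y _; rewrite mule_ge0// lee_fin.
- apply: measurable_funTS.
  apply: emeasurable_funM => //; apply/measurable_EFinP.
  by apply: measurableT_comp mr _; exact: measurable_funB.
Qed.

End one_step.

(** The pinning reward is a rank-one perturbation. *)
Lemma site_op0 (eps : {nonneg R}) (h : R -> \bar R) x :
  (forall x, 0 <= h x) -> measurable_fun [set: measurableTypeR R] h ->
  site_op eps h x = site_op (0%:nng)%R h x + eps%:num%:E * (return_kernel x * h 0%R).
Proof. by move=> h0 mh; rewrite !site_opE//= mul0e adde0. Qed.

Lemma site_op_sum (eps : {nonneg R}) (N : nat) (c : nat -> \bar R) (h : nat -> R -> \bar R) x :
  (forall j, 0 <= c j) -> (forall j y, 0 <= h j y) ->
  (forall j, measurable_fun [set: measurableTypeR R] (h j)) ->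
  site_op eps (fun y => \sum_(j < N) c j * h j y) x =
  \sum_(j < N) c j * site_op eps (h j) x.
Proof.
move=> c0 h0 mh; have m n : measurable_fun [set: measurableTypeR R]
    (fun y => \sum_(j < n) c j * h j y).
  by apply: emeasurable_sum => j; exact: emeasurable_funM.
elim: N => [|N IH].
  rewrite big_ord0 /site_op integral0_eq// => y _.
  by rewrite big_ord0 mule0.
under [in LHS]eq_fun do rewrite big_ord_recr/=.
rewrite site_opD//; last 4 first.
- by move=> y; apply: sume_ge0 => j _; rewrite mule_ge0.
- exact: m.
- by move=> y; rewrite mule_ge0.
- exact: emeasurable_funM.
by rewrite IH site_opZ// big_ord_recr.
Qed.

Section iterates.
Variables (eps : {nonneg R}) (phi : R -> \bar R).
Hypothesis phi0 : forall x, 0 <= phi x.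
Hypothesis mphi : measurable_fun [set: measurableTypeR R] phi.

Lemma iter_site_op_ge0 n x : 0 <= iter n (site_op eps) phi x.
Proof.
elim: n x => [|n IH] x /=; first exact: phi0.
exact: site_op_ge0.
Qed.

Lemma measurable_iter_site_op n :
  measurable_fun [set: measurableTypeR R] (iter n (site_op eps) phi).
Proof.
elim: n => [|n IH] //=; apply: measurable_site_op => // x.
exact: iter_site_op_ge0.
Qed.

End iterates.

(** The term of index [j] collects the configurations whose last visit to zero
    among the [N] sites is at site [j + 1]: the pinned factor up to it comes from
    [site_op eps], and the [N - j.+1] later sites are free of pinning. The
    induction adds a first site, using [site_op0] for the term without visits. *)
Lemma last_visit (eps : {nonneg R}) (phi : R -> \bar R) N x :
  (forall x, 0 <= phi x) -> measurable_fun [set: measurableTypeR R] phi ->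
  iter N (site_op eps) phi x = iter N (site_op (0%:nng)%R) phi x +
    \sum_(j < N) (eps%:num%:E * iter (N - j.+1) (site_op (0%:nng)%R) phi 0%R)
      * iter j (site_op eps) return_kernel x.
Proof.
move=> phi0 mphi; elim: N x => [|N IH] x; first by rewrite big_ord0 adde0.
have rk0 := return_kernel_ge0; have mrk := measurable_return_kernel.
rewrite iterS (funext IH).
rewrite site_opD; last 4 first.
- by move=> y; exact: iter_site_op_ge0.
- exact: measurable_iter_site_op.
- move=> y; apply: sume_ge0 => j _; rewrite mule_ge0// ?iter_site_op_ge0//.
  by rewrite mule_ge0// ?iter_site_op_ge0// lee_fin.
- by apply: emeasurable_sum => j; apply: emeasurable_funM => //; exact: measurable_iter_site_op.
rewrite (@site_op_sum eps N
  (fun j => eps%:num%:E * iter (N - j.+1) (site_op (0%:nng)%R) phi 0%R)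
  (fun j => iter j (site_op eps) return_kernel)); last 3 first.
- by move=> j; rewrite mule_ge0// ?iter_site_op_ge0// lee_fin.
- by move=> j y; exact: iter_site_op_ge0.
- by move=> j; exact: measurable_iter_site_op.
rewrite site_op0; last 2 first.
- by move=> y; exact: iter_site_op_ge0.
- exact: measurable_iter_site_op.
rewrite [in RHS]big_ord_recl /= subn1/= -addeA; congr (_ + (_ + _)).
by rewrite -muleA; congr (_ * _); rewrite muleC.
Qed.

End site.

(** * Partition functions as iterates of the one-step operator *)

Section step_density.
Context {R : realType} (s : setup) (V : R -> \bar R).
Local Notation mu := (base_measure R s).
Local Notation supp := (@base_support R s).
Hypothesis V_gtNy : forall x, (-oo < V x)%E.
Hypothesis V_cont : s = ContinuousSetup -> continuous (fun x => expeR (- V x)%E).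

Lemma weight_fin_num x : expeR (- V x)%E \is a fin_num.
Proof.
by rewrite ge0_fin_numE ?expeR_ge0// ltey expeR_eqy; case: (V x) (V_gtNy x).
Qed.

(** [exp (- V)] is cut off outside the support of the base measure, because in
    the discrete set-up it need not be measurable there. *)
Definition step_density (x : R) : R :=
  ((fun y => fine (expeR (- V y)%E)) \_ supp) x / fine (kappa s V).

Lemma step_density_ge0 x : 0 <= step_density x.
Proof.
apply: divr_ge0.
  by rewrite /patch; case: ifPn => // _; rewrite fine_ge0// expeR_ge0.
by apply: fine_ge0; apply: integral_ge0 => y _; exact: expeR_ge0.
Qed.

Lemma measurable_step_density : measurable_fun [set: measurableTypeR R]
  (step_density : _ -> measurableTypeR R).
Proof.
apply: measurable_funM => //.
apply/(measurable_restrictT _ (@measurable_base_support R s)).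
case: (pselect (s = ContinuousSetup)) => [sC|sD].
  apply: measurable_funTS.
  apply: (@continuous_measurable_fun R) => x.
  apply: fine_cvg; rewrite fineK ?weight_fin_num//; exact: V_cont.
move=> mS B mB; apply: countable_measurable; first by move=> x; exact: measurable_set1.
apply: (@sub_countable _ _ _ supp); first by apply: subset_card_le; exact: subIsetl.
rewrite /base_support; case: s sD => // _.
exact: card_le_trans (card_image_le _ _) (countableP _).
Qed.

Context (k : R) (k_gt0 : 0 < k) (kE : kappa s V = k%:E).

Lemma step_densityE x : supp x -> (k * step_density x)%:E = expeR (- V x)%E.
Proof.
move=> Sx; rewrite /step_density kE/= mulrC divfK ?gt_eqF//.
by rewrite /patch mem_set// fineK// weight_fin_num.
Qed.

Local Open Scope ereal_scope.

Let r := step_density.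

(** The scalar [c] is part of the statement because the weight of the first step
    has to be carried through the inner integrals, whose integrands are not
    known to be measurable: each integral is taken only after its integrand has
    been identified, on the support, with a measurable function. The constant
    [a] is [1] for free and [k] for constrained configurations, where the last
    jump to zero contributes one more factor [kappa]. *)
Lemma iterated_site_integral (eps : {nonneg R}) (phi : R -> \bar R) (a : R)
    (F : forall n : nat, R -> n.-tuple R -> \bar R) :
  (0 <= a)%R -> (forall x, 0 <= phi x) ->
  measurable_fun [set: measurableTypeR R] phi ->
  (forall n x t, 0 <= F n x t) ->
  (forall x, supp x -> F 0%N x [tuple] = a%:E * phi x) ->
  (forall n x y (t : n.-tuple R), supp x -> supp y ->
     F n.+1 x [tuple of y :: t] = (k * r (y - x))%:E * F n y t) ->
  forall n x c, supp x -> (0 <= c)%R ->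
  iterated_integral (site_measure s eps) `[0%R, +oo[ (fun t => c%:E * F n x t) =
  (c * (k ^+ n * a))%:E * iter n (site_op s r eps) phi x.
Proof.
move=> a0 phi0 mphi Fge0 F0 FS.
have r0 := step_density_ge0; have mr := measurable_step_density.
elim=> [|n IH] x c Sx c0; first by rewrite /= F0// muleA expr0 mul1r -EFinM.
rewrite iterS /=.
transitivity (\int[site_measure s eps]_(y in `[0%R, +oo[)
   ((c * (k ^+ n.+1 * a))%:E * ((r (y - x))%:E * iter n (site_op s r eps) phi y))).
  apply: (@carrier_eq_integral _ (measurableTypeR R) R (site_measure s eps) supp `[0%R, +oo[).
  - exact: measurable_base_support.
  - exact: site_measure_support.
  - by move=> y _; apply: iterated_integral_ge0 => t; rewrite mule_ge0.
  - move=> y _; rewrite mule_ge0// ?lee_fin ?mulr_ge0// ?exprn_ge0 ?(ltW k_gt0)//.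
    by rewrite mule_ge0// ?lee_fin//; exact: iter_site_op_ge0.
  - move=> y _ Sy.
    rewrite (_ : (fun t => _) = fun t => (c * (k * r (y - x)))%:E * F n y t).
      rewrite IH//; last by apply: mulr_ge0 => //; apply: mulr_ge0; [exact: ltW|exact: r0].
      by rewrite muleA -EFinM; congr (_%:E * _); rewrite exprS; ring.
    by apply/funext => t; rewrite FS// muleA -EFinM.
rewrite ge0_integralZl//.
- by apply: measurable_funTS; apply: measurable_step => //; exact: measurable_iter_site_op.
- move=> y _; rewrite mule_ge0// ?lee_fin//; exact: iter_site_op_ge0.
- by rewrite lee_fin !mulr_ge0// exprn_ge0// (ltW k_gt0).
Qed.

(* The energies below start from an arbitrary height [x], so that the first site
   can be removed. *)
Let hgt (n : nat) (x : R) (t : n.-tuple R) (i : nat) : R := nth 0%R (x :: t) i.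
Arguments hgt {n}.

Let Hsum (m n : nat) (x : R) (t : n.-tuple R) : \bar R :=
  \sum_(0 <= i < m) V (hgt x t i.+1 - hgt x t i)%R.
Arguments Hsum m {n}.

Let HsumS m n x y (t : n.-tuple R) :
  Hsum m.+1 x [tuple of y :: t] = V (y - x)%R + Hsum m y t.
Proof. by rewrite /Hsum big_nat_recl. Qed.

Let Hsum_gtNy m n x (t : n.-tuple R) : -oo < Hsum m x t.
Proof.
rewrite ltNye; apply/eqP => /esum_eqNyP[i [_ _ VN]].
by have := V_gtNy (hgt x t i.+1 - hgt x t i); rewrite VN.
Qed.

Let expeR_HsumS m n x y (t : n.-tuple R) : supp x -> supp y ->
  expeR (- Hsum m.+1 x [tuple of y :: t]) = (k * r (y - x))%:E * expeR (- Hsum m y t).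
Proof.
move=> Sx Sy; rewrite HsumS step_densityE; last exact: base_supportB.
rewrite -expeRD; congr expeR; apply: oppeD.
move: (V_gtNy (y - x)) (Hsum_gtNy m _ y t).
by case: (V _) => [u||]//; case: (Hsum _ _ _) => [v||].
Qed.

Lemma ZfE (eps : {nonneg R}) N :
  Zf s V eps N = (k ^+ N)%:E * iter N (site_op s r eps) (cst 1) 0%R.
Proof.
have := @iterated_site_integral eps (cst 1) 1%R (fun n x t => expeR (- Hsum n x t)).
move=> /(_ ler01 (fun=> lee01) (measurable_cst _) (fun _ _ _ => expeR_ge0 _)).
move=> /(_ _ _ N 0%R 1%R (@base_support0 R s) ler01).
rewrite mul1r mulr1 => <-; last 2 first.
- by move=> x _; rewrite /Hsum big_geq// oppe0 expeR0 mule1.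
- by move=> n x y t; exact: expeR_HsumS.
by congr iterated_integral; apply/funext => x; rewrite mul1e.
Qed.

Lemma ZcE (eps : {nonneg R}) N :
  Zc s V eps N = (k ^+ N.+1)%:E * iter N (site_op s r eps) (return_kernel r) 0%R.
Proof.
have := @iterated_site_integral eps (return_kernel r) k
  (fun n x t => expeR (- Hsum n.+1 x t)).
move=> /(_ (ltW k_gt0) (return_kernel_ge0 _ step_density_ge0)).
move=> /(_ (measurable_return_kernel _ measurable_step_density)).
move=> /(_ (fun _ _ _ => expeR_ge0 _)).
move=> /(_ _ _ N 0%R 1%R (@base_support0 R s) ler01).
rewrite mul1r -exprSr => <-; last 2 first.
- move=> x Sx; rewrite /Hsum big_nat1 /hgt/= sub0r -EFinM step_densityE//.
  by rewrite -sub0r; apply: base_supportB => //; exact: base_support0.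
- by move=> n x y t; exact: expeR_HsumS.
by congr iterated_integral; apply/funext => x; rewrite mul1e.
Qed.

End step_density.

(** * Product laws, densities and translations *)

Section image_measure.
Context d1 d2 (T1 : measurableType d1) (T2 : measurableType d2) (R : realType).
Variables (nu : {finite_measure set T1 -> \bar R}) (f : {mfun T1 >-> T2}).

(** The push-forward by a bundled measurable function, so that it carries the
    structure of a finite measure. *)
Definition image_measure : set T2 -> \bar R := pushforward nu f.

Let image_measure0 : image_measure set0 = 0%E.
Proof. exact: measure0. Qed.

Let image_measure_ge0 A : (0 <= image_measure A)%E.
Proof. exact: measure_ge0. Qed.

Let image_measure_sigma_additive : semi_sigma_additive image_measure.
Proof. exact: measure_semi_sigma_additive. Qed.

HB.instance Definition _ := isMeasure.Build _ _ _ image_measure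
  image_measure0 image_measure_ge0 image_measure_sigma_additive.

Let image_measure_fin : fin_num_fun image_measure.
Proof.
move=> A mA; apply: fin_num_measure.
by rewrite -[X in measurable X]setTI; exact: (measurable_funPT f).
Qed.

HB.instance Definition _ :=
  Measure_isFinite.Build _ _ _ image_measure image_measure_fin.

Lemma integral_image_measure (F : T2 -> \bar R) :
  (forall y, 0 <= F y)%E -> measurable_fun [set: T2] F ->
  (\int[image_measure]_y F y = \int[nu]_x F (f x))%E.
Proof.
by move=> F0 mF; rewrite [LHS]ge0_integral_pushforward.
Qed.

End image_measure.
Arguments image_measure {d1 d2 T1 T2 R}.

Section rectangles.
Context d1 d2 (T1 : measurableType d1) (T2 : measurableType d2) (R : realType).
Variables (m1 : {finite_measure set T1 -> \bar R}) (m2 : {finite_measure set T2 -> \bar R}).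
Local Open Scope ereal_scope.

Lemma eq_measure_rectangles (n1 n2 : {measure set (T1 * T2) -> \bar R}) :
  (forall A B, measurable A -> measurable B -> n1 (A `*` B) = m1 A * m2 B) ->
  (forall A B, measurable A -> measurable B -> n2 (A `*` B) = m1 A * m2 B) ->
  forall X, measurable X -> n1 X = n2 X.
Proof.
move=> h1 h2 X mX.
by rewrite -(product_measure_unique h1)// (product_measure_unique h2).
Qed.

End rectangles.

Section density.
Context d (T : measurableType d) (R : realType).
Variables (m nu : {measure set T -> \bar R}) (r : T -> R).
Hypothesis r_ge0 : forall x, 0 <= r x.
Hypothesis mr : measurable_fun [set: T] r.
Local Open Scope ereal_scope.
Hypothesis nuE : forall A, measurable A -> nu A = \int[m]_(x in A) (r x)%:E.
Import HBSimple HBNNSimple.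

Let integral_density_nnsfun (h : {nnsfun T >-> R}) :
  \int[nu]_x (h x)%:E = \int[m]_x ((r x)%:E * (h x)%:E).
Proof.
have mrE : measurable_fun [set: T] (EFin \o r) by exact/measurable_EFinP.
have E : \int[m]_x ((r x)%:E * (h x)%:E) =
    \int[m]_x (\sum_(y \in range h) ((r x)%:E * (y * \1_(h @^-1` [set y]) x)%:E)).
  apply: eq_integral => x _; rewrite fimfunE -fsumEFin// ge0_mule_fsumr//.
  by move=> y; rewrite EFinM nnfun_muleindic_ge0.
rewrite E ge0_integral_fsum//; last 2 first.
- move=> y; apply: emeasurable_funM => //.
  by apply/measurable_EFinP; exact: measurable_funM.
- move=> y x _; apply: mule_ge0; first by rewrite lee_fin.
  by rewrite EFinM nnfun_muleindic_ge0.
rewrite (_ : \int[nu]_x _ =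
  \int[nu]_x (\sum_(y \in range h) (y * \1_(h @^-1` [set y]) x)%:E)); last first.
  by apply: eq_integral => x _; rewrite fimfunE -fsumEFin.
rewrite ge0_integral_fsum//; last 2 first.
- by move=> y; apply/measurable_EFinP; exact: measurable_funM.
- by move=> y x _; rewrite EFinM nnfun_muleindic_ge0.
apply: eq_fsbigr => y /set_mem[x0 _ <-].
have h0 : (0 <= h x0)%R by exact: fun_ge0.
set A := h @^-1` _; have mA : measurable A by exact: measurable_sfunP.
under eq_integral do rewrite EFinM.
rewrite ge0_integralZl ?lee_fin//; last exact/measurable_EFinP/measurable_indic.
rewrite integral_indic// setIT nuE//.
under [RHS]eq_integral do rewrite EFinM muleCA.
rewrite ge0_integralZl ?lee_fin//; last 2 first.
- apply: emeasurable_funM => //; apply/measurable_EFinP; exact: measurable_indic.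
- by move=> x _; rewrite mule_ge0// lee_fin.
by rewrite integral_mkcond epatch_indic.
Qed.

(** Simple functions first, then monotone convergence. *)
Lemma ge0_integral_density (F : T -> \bar R) :
  (forall x, 0 <= F x) -> measurable_fun [set: T] F ->
  \int[nu]_x F x = \int[m]_x ((r x)%:E * F x).
Proof.
move=> F0 mF; pose f_ := nnsfun_approx measurableT mF.
have mrE : measurable_fun [set: T] (EFin \o r) by exact/measurable_EFinP.
transitivity (limn (fun n => \int[nu]_x (f_ n x)%:E)).
  rewrite -monotone_convergence//=.
  - by apply: eq_integral => x _; apply/esym/cvg_lim => //; exact: cvg_nnsfun_approx.
  - by move=> n; exact/measurable_EFinP.
  - by move=> n x _; rewrite lee_fin.
  - by move=> x _ a b ab; rewrite lee_fin; exact/lefP/nd_nnsfun_approx.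
transitivity (limn (fun n => \int[m]_x ((r x)%:E * (f_ n x)%:E))).
  by congr (limn _); apply/funext => n; exact: integral_density_nnsfun.
rewrite -monotone_convergence//=.
- apply: eq_integral => x _; apply/cvg_lim => //; apply: cvgeZl => //.
  exact: cvg_nnsfun_approx.
- by move=> n; apply: emeasurable_funM => //; exact/measurable_EFinP.
- by move=> n x _; rewrite mule_ge0// lee_fin.
- move=> x _ a b ab; rewrite lee_wpmul2l// ?lee_fin//.
  exact/lefP/nd_nnsfun_approx.
Qed.

End density.

Section base_translation.
Context {R : realType} (s : setup).
Local Notation mu := (base_measure R s).
Local Open Scope ereal_scope.

Lemma integral_base_translation (x : R) (F : R -> \bar R) :
  base_support R s x -> (forall y, 0 <= F y) ->
  measurable_fun [set: measurableTypeR R] F ->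
  \int[mu]_z F (x + z)%R = \int[mu]_y F y.
Proof.
move=> Sx F0 mF.
have mD : measurable_fun [set: measurableTypeR R]
    ((fun y => x + y)%R : _ -> measurableTypeR R) by exact: measurable_funD.
have := @ge0_integral_pushforward _ _ (measurableTypeR R) (measurableTypeR R) R
  _ mD mu setT F measurableT mF (fun y _ => F0 y).
rewrite preimage_setT => <-; apply: eq_measure_integral => A mA _.
exact: base_measure_translation.
Qed.

End base_translation.

(** * The walk killed on leaving the positive half-line *)

Section walk.
Context d (T : measurableType d) (R : realType) (P : probability T R).
Variable Y : nat -> {RV P >-> R}.
Local Notation S := (walk Y).
Local Notation RR := (measurableTypeR R).

Lemma measurable_walk n : measurable_fun [set: T] (S n : T -> RR).
Proof. by apply: measurable_sum => i; exact: measurable_funPT. Qed.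

Definition walk_mfun n : {mfun T >-> RR} :=
  HB.pack (S n : T -> RR) (isMeasurableFun.Build _ _ T RR (S n) (measurable_walk n)).

Definition step_mfun n : {mfun T >-> RR} :=
  HB.pack (Y n : T -> RR)
    (isMeasurableFun.Build _ _ T RR (Y n) (@measurable_funPT _ _ _ _ (Y n))).

Definition next_pair n (w : T) : RR * RR := (S n w, Y n w).

Lemma measurable_next_pair n : measurable_fun [set: T] (next_pair n).
Proof.
apply/measurable_fun_pairP; split; first exact: measurable_walk.
exact: (measurable_funPT (Y n)).
Qed.

Definition next_pair_mfun n : {mfun T >-> (RR * RR)%type} :=
  HB.pack (next_pair n)
    (isMeasurableFun.Build _ _ T (RR * RR)%type (next_pair n) (measurable_next_pair n)).

Definition stays_positive n : set T :=
  [set w | forall i : nat, (1 <= i <= n)%N -> 0 < S i w].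

Lemma walk0 w : S 0 w = 0.
Proof. by rewrite /walk big_ord0. Qed.

Lemma walkS n w : S n.+1 w = S n w + Y n w.
Proof. by rewrite /walk big_ord_recr. Qed.

Lemma stays_positive0 : stays_positive 0 = setT.
Proof. by apply/seteqP; split => // w _ i; case: i. Qed.

Lemma stays_positiveS n :
  stays_positive n.+1 = stays_positive n `&` [set w | 0 < S n.+1 w].
Proof.
apply/seteqP; split => [w H|w [H Sw] i /andP[i1]].
  split=> [i /andP[i1 i_n]|]; first by apply: H; rewrite i1 ltnW.
  by apply: H; rewrite leqnn.
by rewrite leq_eqVlt => /predU1P[->//|i_n]; apply: H; rewrite i1.
Qed.

Lemma measurable_stays_positive n : measurable (stays_positive n).
Proof.
elim: n => [|n IH]; first by rewrite stays_positive0.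
rewrite stays_positiveS; apply: measurableI => //.
rewrite (_ : [set w | _] = S n.+1 @^-1` `]0, +oo[).
  by rewrite -[X in measurable X]setTI; apply: measurable_walk => //; exact: measurable_itv.
by apply/seteqP; split => w /=; rewrite in_itv/= andbT.
Qed.

Local Open Scope ereal_scope.
Hypothesis Y_indep : mutually_independent Y.

Definition cylinder (sq : seq nat) (A : nat -> set R) : set T :=
  \bigcap_(i in [set` sq]) (Y i @^-1` A i).

Lemma cylinder_nil A : cylinder [::] A = setT.
Proof. by apply/seteqP; split => // w _ i. Qed.

Lemma cylinder_cons n sq A : cylinder (n :: sq) A = Y n @^-1` A n `&` cylinder sq A.
Proof.
apply/seteqP; split => [w H|w [Hn H] i].
  split; first by apply: H; rewrite /= inE eqxx.
  by move=> i isq; apply: H; rewrite /= inE; apply/orP; right.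
by rewrite /= inE => /predU1P[->//|isq]; exact: H.
Qed.

Lemma measurable_preimage_Y i A : measurable (A : set RR) -> measurable (Y i @^-1` A).
Proof. by move=> mA; rewrite -[X in measurable X]setTI; exact: (measurable_funPT (Y i)). Qed.

Lemma measurable_cylinder sq A : (forall i, measurable (A i : set RR)) ->
  measurable (cylinder sq A).
Proof.
move=> mA; elim: sq => [|n sq IH]; first by rewrite cylinder_nil.
by rewrite cylinder_cons; apply: measurableI => //; exact: measurable_preimage_Y.
Qed.

(** Independence of all the steps from time [n] on, tested on cylinders. *)
Definition independent_of_future n (E : set T) : Prop :=
  forall sq A, uniq sq -> (forall i, i \in sq -> (n <= i)%N) ->
    (forall i, measurable (A i : set RR)) ->
    P (E `&` cylinder sq A) = P E * P (cylinder sq A).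

Lemma cylinder_prod sq A : uniq sq -> (forall i, measurable (A i : set RR)) ->
  P (cylinder sq A) = \prod_(i <- sq) P (Y i @^-1` A i).
Proof. exact: Y_indep. Qed.

(** For the induction step, compare the two finite measures of a set [X] of
    pairs: [P (past, (S n, Y n) in X, future)] and
    [P future * P (past, (S n, Y n) in X)]. By the induction hypothesis they
    agree on rectangles, hence everywhere; take for [X] the pairs of positive sum
    in [D]. *)
Lemma walk_past_independent n (D : set RR) : measurable D ->
  independent_of_future n (stays_positive n `&` S n @^-1` D).
Proof.
elim: n D => [|n IH] D mD sq A usq sqn mA.
  have -> : S 0%N = cst 0%R by apply/funext => w; rewrite walk0.
  rewrite stays_positive0 setTI preimage_cst; case: ifPn => _.
    by rewrite setTI probability_setT mul1e.
  by rewrite set0I measure0 mul0e.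
have mG := measurable_stays_positive n.
have mE := measurable_cylinder sq A mA.
pose G := stays_positive n; pose E := cylinder sq A.
pose muG : {finite_measure set T -> \bar R} := mrestr P mG.
pose muGE : {finite_measure set T -> \bar R} := mrestr P (measurableI _ _ mG mE).
pose c : {nonneg R} := NngNum (fine_ge0 (measure_ge0 P E)).
have cE : c%:num%:E = P E by rewrite /= fineK// fin_num_measure.
pose m1 : {finite_measure set RR -> \bar R} := mscale c (image_measure muG (walk_mfun n)).
pose m2 : {finite_measure set RR -> \bar R} := image_measure P (step_mfun n).
pose n1 : {measure set (RR * RR) -> \bar R} := image_measure muGE (next_pair_mfun n).
pose n2 : {measure set (RR * RR) -> \bar R} := mscale c (image_measure muG (next_pair_mfun n)).
have key sq' A' B C : uniq sq' -> (forall i, i \in sq' -> (n.+1 <= i)%N) ->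
    (forall i, measurable (A' i : set RR)) -> measurable B -> measurable C ->
    P ((next_pair n @^-1` (B `*` C)) `&` (G `&` cylinder sq' A')) =
    P (S n @^-1` B `&` G) * P (Y n @^-1` C) * P (cylinder sq' A').
  move=> usq' sqn' mA' mB mC.
  pose A2 i := if i == n then C else A' i.
  have mA2 i : measurable (A2 i : set RR) by rewrite /A2; case: ifP.
  have A2n : A2 n = C by rewrite /A2 eqxx.
  have nsq : n \notin sq' by apply/negP => /sqn'; rewrite ltnn.
  have cyl : cylinder sq' A2 = cylinder sq' A'.
    apply: eq_bigcapr => i; rewrite /= /A2; case: eqP => // -> nin.
    by rewrite nin in nsq.
  have -> : (next_pair n @^-1` (B `*` C)) `&` (G `&` cylinder sq' A') =
      (G `&` S n @^-1` B) `&` cylinder (n :: sq') A2.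
    rewrite cylinder_cons cyl A2n.
    by apply/seteqP; split => w /=; tauto.
  rewrite IH//; last 2 first.
  - by rewrite /= nsq.
  - by move=> i; rewrite inE => /predU1P[->//|/sqn' /ltnW].
  rewrite [G `&` _]setIC -muleA; congr (_ * _).
  have ucons : uniq (n :: sq') by rewrite /= nsq.
  rewrite (cylinder_prod _ _ ucons mA2) big_cons A2n.
  by rewrite -(cylinder_prod _ _ usq' mA2) cyl.
have n12 X : measurable X -> n1 X = n2 X.
  apply: (@eq_measure_rectangles _ _ _ _ _ m1 m2) => B C mB mC.
    rewrite -[LHS]/(P ((next_pair n @^-1` (B `*` C)) `&` (G `&` E))).
    rewrite key//.
    rewrite -[m1 B]/(c%:num%:E * P (S n @^-1` B `&` G)) cE.
    rewrite -[m2 C]/(P (Y n @^-1` C)).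
    by rewrite muleC muleA.
  rewrite -[LHS]/(c%:num%:E * P ((next_pair n @^-1` (B `*` C)) `&` G)).
  have := key [::] A B C isT (fun _ => ltac:(by [])) mA mB mC.
  rewrite cylinder_nil setIT probability_setT mule1 => ->.
  by rewrite muleA.
pose X := [set z : RR * RR | (0 < z.1 + z.2)%R] `&` [set z : RR * RR | D (z.1 + z.2)%R].
have mX : measurable X.
  have madd : measurable_fun [set: RR * RR] (fun z : RR * RR => (z.1 + z.2)%R : RR).
    by apply: measurable_funD; [exact: measurable_fst|exact: measurable_snd].
  rewrite (_ : X = (fun z : RR * RR => (z.1 + z.2)%R : RR) @^-1` (`]0%R, +oo[ `&` D)).
    rewrite -[Z in measurable Z]setTI; apply: madd => //.
    by apply: measurableI => //; exact: measurable_itv.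
  by apply/seteqP; split => z /=; rewrite in_itv/= andbT.
have SX : stays_positive n.+1 `&` S n.+1 @^-1` D = next_pair n @^-1` X `&` G.
  rewrite stays_positiveS; by apply/seteqP; split => w; rewrite /X /= !walkS; tauto.
have := n12 X mX.
rewrite -[n1 X]/(P (next_pair n @^-1` X `&` (G `&` E))).
rewrite -[n2 X]/(c%:num%:E * P (next_pair n @^-1` X `&` G)).
by rewrite cE -SX setIA -SX muleC.
Qed.

Local Notation restr n := (mrestr P (measurable_stays_positive n)).

(** Given the past, [Y n] is integrated out against its law: the joint law of
    [S n] and [Y n] on the event of staying positive is a product measure. *)
Lemma killed_markov n (F : RR * RR -> \bar R) :
  (forall z, 0 <= F z) -> measurable_fun [set: RR * RR] F ->
  \int[restr n]_w F (S n w, Y n w) =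
  \int[restr n]_w \int[image_measure P (step_mfun n)]_z F (S n w, z).
Proof.
move=> F0 mF.
pose nu : {finite_measure set T -> \bar R} := restr n.
pose m1 : {finite_measure set RR -> \bar R} := image_measure nu (walk_mfun n).
pose m2 : {finite_measure set RR -> \bar R} := image_measure P (step_mfun n).
transitivity (\int[image_measure nu (next_pair_mfun n)]_z F z).
  by rewrite integral_image_measure.
transitivity (\int[m1 \x m2]_z F z).
  apply: eq_measure_integral => X mX _; apply/esym.
  apply: product_measure_unique mX => B C mB mC.
  have := walk_past_independent n B mB [:: n] (fun _ => C) isT.
  rewrite cylinder_cons cylinder_nil setIT => H.
  rewrite -[LHS]/(P (next_pair n @^-1` (B `*` C) `&` stays_positive n)).
  rewrite -[RHS]/(P (S n @^-1` B `&` stays_positive n) * P (Y n @^-1` C)).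
  rewrite [S n @^-1` B `&` _]setIC -H//.
    by congr (P _); apply/seteqP; split => w /=; tauto.
  by move=> i; rewrite inE => /eqP->.
rewrite fubini_tonelli1// integral_image_measure//.
  by move=> x; apply: integral_ge0 => z _; exact: F0.
exact: measurable_fun_fubini_tonelli_F.
Qed.

Context (s : setup) (V : R -> \bar R).
Local Notation mu := (base_measure R s).
Local Notation supp := (@base_support R s).
Hypothesis V_gtNy : forall x, -oo < V x.
Hypothesis V_cont : s = ContinuousSetup -> continuous (fun x => expeR (- V x)).
Hypothesis Y_law : forall i, has_step_law s V (Y i).
Context (k : R) (k_gt0 : (0 < k)%R) (kE : kappa s V = k%:E).
Let r := step_density s V.
Let r0 := step_density_ge0 s V.
Let mr := measurable_step_density s V V_gtNy V_cont.

Lemma step_lawE n A : measurable (A : set RR) ->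
  image_measure P (step_mfun n) A = \int[mu]_(x in A) (r x)%:E.
Proof.
move=> mA; rewrite -[LHS]/(distribution P (Y n) A) Y_law// kE.
rewrite inver gt_eqF//.
transitivity (k^-1%:E * \int[mu]_(x in A) (k%:E * (r x)%:E)).
  congr (_ * _).
  apply: (@carrier_eq_integral _ RR R mu supp A).
  - exact: measurable_base_support.
  - exact: base_measure_support.
  - by move=> x _; exact: expeR_ge0.
  - by move=> x _; rewrite mule_ge0// lee_fin// ltW.
  - by move=> x _ Sx; rewrite -EFinM (step_densityE s V V_gtNy k).
rewrite ge0_integralZl//.
- by rewrite muleA -EFinM mulVf ?gt_eqF// mul1e.
- by apply: measurable_funTS; exact/measurable_EFinP.
- by move=> x _; rewrite lee_fin.
- by rewrite lee_fin ltW.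
Qed.

Lemma step_support n : P (Y n @^-1` (~` supp)) = 0.
Proof.
have mS := @measurable_base_support R s.
have mC : measurable (~` supp : set RR) by exact: measurableC.
rewrite -[LHS]/(image_measure P (step_mfun n) (~` supp)) step_lawE//.
transitivity (\int[mu]_(x in ~` supp) (cst 0 x : \bar R)); last exact: integral0.
apply: (@carrier_eq_integral _ RR R mu supp) => //.
- exact: base_measure_support.
- by move=> x _; rewrite lee_fin.
Qed.

(** The walk starts at zero and the support is closed under addition. *)
Lemma walk_support n : P (S n @^-1` (~` supp)) = 0.
Proof.
have mC : measurable (~` supp : set RR).
  by apply: measurableC; exact: measurable_base_support.
have mSn i : measurable (S i @^-1` (~` supp)).
  by rewrite -[X in measurable X]setTI; exact: measurable_walk.
elim: n => [|n IH].
  rewrite (_ : S 0%N @^-1` _ = set0) ?measure0//.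
  by rewrite -subset0 => w; apply; rewrite walk0; exact: base_support0.
have null : P (S n @^-1` (~` supp) `|` Y n @^-1` (~` supp)) = 0.
  apply: null_set_setU => //; first exact: measurable_preimage_Y.
  exact: step_support.
apply: subset_measure0 null => //.
  by apply: measurableU => //; exact: measurable_preimage_Y.
move=> w /=; rewrite walkS => nS; apply: contrapT => /not_orP[/contrapT ? /contrapT ?].
by apply: nS; exact: base_supportD.
Qed.

(** One step of the walk started at [x] and killed on leaving the positive
    half-line is one unpinned site: write the law of the step with its density
    and translate the base measure by [x], which preserves it as [x] lies in the
    support. *)
Lemma positive_step n x (h : R -> \bar R) : supp x ->
  (forall y, 0 <= h y) -> measurable_fun [set: RR] h ->
  \int[image_measure P (step_mfun n)]_z (h \_ `]0%R, +oo[) (x + z)%R =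
  site_op s r (0%:nng)%R h x.
Proof.
move=> Sx h0 mh; pose h' := h \_ `]0%R, +oo[.
have mI : measurable (`]0%R, +oo[ : set RR) by exact: measurable_itv.
have mh' : measurable_fun [set: RR] h'.
  by apply/(measurable_restrictT _ mI); exact: measurable_funTS.
have h'0 y : 0 <= h' y by rewrite /h' /patch; case: ifP.
rewrite (@ge0_integral_density _ _ _ mu _ r r0 mr (step_lawE n)); last 2 first.
- by move=> z; exact: h'0.
- by apply: measurableT_comp mh' _; exact: measurable_funD.
rewrite site_opE//= mul0e adde0.
transitivity (\int[mu]_z (fun y => (r (y - x))%:E * h' y) (x + z)%R).
  by apply: eq_integral => z _; rewrite /= addrAC subrr add0r.
rewrite (@integral_base_translation _ _ x (fun y => (r (y - x))%:E * h' y))//.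
- rewrite [RHS]integral_mkcond; apply: eq_integral => y _.
  by rewrite /h' /patch; case: ifP => // _; rewrite mule0.
- by move=> y; rewrite mule_ge0// lee_fin.
- exact: measurable_step.
Qed.

(** The induction peels off the last step of the walk, which replaces [h] by
    [site_op h]; on the operator side this is the innermost application. *)
Lemma killed_expectation n (h : R -> \bar R) :
  (forall y, 0 <= h y) -> measurable_fun [set: RR] h ->
  \int[restr n]_w h (S n w) = iter n (site_op s r (0%:nng)%R) h 0%R.
Proof.
elim: n h => [|n IH] h h0 mh.
  transitivity (\int[restr 0]_w cst (h 0%R) w).
    by apply: eq_integral => w _; rewrite walk0.
  rewrite integral_cst// -[X in _ * X]/(P (setT `&` stays_positive 0)).
  by rewrite stays_positive0 setTI probability_setT mule1.
pose h' := h \_ `]0%R, +oo[.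
have mI : measurable (`]0%R, +oo[ : set RR) by exact: measurable_itv.
have mh' : measurable_fun [set: RR] h'.
  by apply/(measurable_restrictT _ mI); exact: measurable_funTS.
have h'0 y : 0 <= h' y by rewrite /h' /patch; case: ifP.
transitivity (\int[restr n]_w h' (S n w + Y n w)%R).
  rewrite !integral_mrestr// !setTI stays_positiveS integral_mkcondr.
  apply: eq_integral => w _; rewrite -walkS /h' /patch.
  by congr (if _ then _ else _); apply/idP/idP; rewrite !inE/= in_itv/= andbT.
rewrite (killed_markov n (fun z => h' (z.1 + z.2)%R)); last 2 first.
- by move=> z; exact: h'0.
- apply: measurableT_comp mh' _.
  by apply: measurable_funD; [exact: measurable_fst|exact: measurable_snd].
rewrite iterSr -IH; last 2 first.
- by move=> y; exact: site_op_ge0.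
- exact: measurable_site_op.
apply: (@carrier_eq_integral _ T R (restr n) (S n @^-1` supp)).
- by rewrite -[X in measurable X]setTI; apply: measurable_walk => //; exact: measurable_base_support.
- move=> A mA.
  have mSs : measurable (S n @^-1` supp).
    by rewrite -[X in measurable X]setTI; apply: measurable_walk => //; exact: measurable_base_support.
  have mG := measurable_stays_positive n.
  rewrite -[LHS]/(P (A `&` stays_positive n)).
  rewrite -[RHS]/(P (A `&` S n @^-1` supp `&` stays_positive n)).
  rewrite setIAC -[in LHS](setUIDK (A `&` stays_positive n) (S n @^-1` supp)).
  apply: measureU0; [| |].
  + by do 2 apply: measurableI => //.
  + by apply: measurableD => //; exact: measurableI.
  apply: subset_measure0 (walk_support n) => //.
  + by apply: measurableD => //; exact: measurableI.
  + by rewrite preimage_setC; exact: measurableC.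
- by move=> w _; apply: integral_ge0 => z _; exact: h'0.
- by move=> w _; exact: site_op_ge0.
- by move=> w _ Sw; exact: positive_step.
Qed.

Lemma prob_positiveE n :
  prob_positive Y n = iter n (site_op s r (0%:nng)%R) (cst 1) 0%R.
Proof.
rewrite -killed_expectation// integral_cst// mul1e.
by rewrite -[RHS]/(P (setT `&` stays_positive n)) setTI.
Qed.

End walk.
Arguments stays_positive {d T R P}.
Arguments prob_positiveE {d T R P Y}.

(** * Renewal sequences under an exponential tilt *)

Section series_transfer.
Context {R : realType}.
Implicit Types (b : nat -> R).

Lemma eseries_shift1 (F : nat -> \bar R) (G : nat -> \bar R) :
  (forall n, 0 <= G n)%E -> (forall n, F n.+1 = G n) ->
  (\sum_(1 <= n <oo) F n = \sum_(0 <= n <oo) G n)%E.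
Proof.
move=> G0 FG; pose F' n := if n is m.+1 then G m else 0%E.
have F'0 n : (0 <= F' n)%E by case: n.
rewrite (_ : (\sum_(1 <= n <oo) F n)%E = (\sum_(1 <= n <oo) F' n)%E).
  rewrite -(@nneseries_addn _ F' 1%N)//.
  by apply: eq_eseriesr => n _; rewrite addn1.
congr (limn _); apply/funext => n; apply: eq_big_nat => i /andP[].
by case: i => // i _ _; rewrite FG.
Qed.

Lemma cvg_series_EFin b l : (forall n, 0 <= b n) ->
  (\sum_(0 <= n <oo) (b n)%:E = l%:E)%E -> series b @ \oo --> l.
Proof.
move=> b0 bl.
have cv : cvgn (fun n => \sum_(0 <= i < n) (b i)%:E)%E.
  by apply: is_cvg_nneseries => n _ _; rewrite lee_fin.
have : (fun n => (series b n)%:E) @ \oo --> l%:E.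
  rewrite -bl (_ : (fun n => _) = (fun n => \sum_(0 <= i < n) (b i)%:E)%E)//.
  by apply/funext => n; rewrite /series/= sumEFin.
by move/fine_cvgP => [_].
Qed.

Lemma eseries_EFin b l : (series b @ \oo --> l) ->
  (\sum_(0 <= n <oo) (b n)%:E = l%:E)%E.
Proof.
move=> bl; apply/cvg_lim => //.
rewrite (_ : (fun n => _) = (fun n => (series b n)%:E)).
  exact: cvg_EFin (nearW _ _) bl.
by apply/funext => n; rewrite /series/= sumEFin.
Qed.

(** Multiplication by [expR (n f)] undoes the exponential tilt. *)
Lemma asymp_equiv_EFin (w : nat -> R) (l f : R) : l != 0 -> w @ \oo --> l ->
  asymp_equiv (fun n => (w n * expR (n%:R * f))%:E)
              (fun n => (l * expR (n%:R * f))%:E).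
Proof.
move=> l0 wl; rewrite /asymp_equiv.
rewrite (_ : (fun n => _) = (fun n => (w n / l)%:E)); last first.
  apply/funext => n; have e0 := expR_gt0 (n%:R * f).
  rewrite inver mulf_eq0 (negbTE l0) gt_eqF//= -EFinM; congr (_%:E).
  by field; rewrite l0 gt_eqF.
apply: cvg_EFin; first exact: nearW.
by rewrite -(divff l0); apply: cvgMl.
Qed.

End series_transfer.

Lemma cvg_series_exp_bound (R : realType) (f M : R) (g : nat -> R) :
  0 < f -> (forall n, 0 <= g n) -> (forall n, g n <= M * expR (- f * n%:R)) ->
  cvgn (series g).
Proof.
move=> f0 g0 gM.
have geo n : M * expR (- f * n%:R) = geometric M (expR (- f)) n.
  by rewrite /geometric/= expRM_natr.
apply: (series_le_cvg g0 _ gM) => [n|]; first exact: le_trans (gM n).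
under [in X in cvgn X]eq_fun do rewrite geo.
apply/cvg_ex; eexists; apply: cvg_geometric_series.
by rewrite ger0_norm ?expR_ge0// expR_lt1 oppr_lt0.
Qed.

(** In [u_rec], [a n] is the weight of a gap of length [n + 1], so that its tilt
    is [expR (- f * (n + 1))]. *)
Section exponential_renewal.
Context {R : realType} (f M : R) (a u p : nat -> R).
Hypothesis f_gt0 : 0 < f.
Hypothesis a_ge0 : forall n, 0 <= a n.
Hypothesis a_leM : forall n, a n <= M.
Hypothesis a0_gt0 : 0 < a 0%N.
Hypothesis p01 : forall n, 0 <= p n <= 1.
Hypothesis p0 : p 0%N = 1.
Hypothesis u0 : u 0%N = 1.
Hypothesis u_rec : forall n, u n.+1 = \sum_(k < n.+1) a k * u (n - k)%N.

Let b n := a n * expR (- f * n.+1%:R).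
Hypothesis b_sum : series b @ \oo --> (1 : R).

Let v n := u n * expR (- f * n%:R).
Let surv n := expR (- f * n%:R) * p n.

Let b_ge0 n : 0 <= b n. Proof. by rewrite mulr_ge0// expR_ge0. Qed.

Let v_rec n : v n.+1 = \sum_(k < n.+1) b k * v (n - k)%N.
Proof.
rewrite /v u_rec mulr_suml; apply: eq_bigr => k _.
have kn : (k <= n)%N by rewrite -ltnS.
rewrite /b mulrACA -expRD; congr (_ * expR _).
by rewrite natrB// -!natr1; ring.
Qed.

Let v0 : v 0%N = 1.
Proof. by rewrite /v u0 mul1r mulr0 expR0. Qed.

(** Half of the exponential decay absorbs the factor [n + 1], by
    [x <= exp x]. *)
Lemma is_cvg_mean : cvgn (series (fun n => n.+1%:R * b n)).
Proof.
apply: (@cvg_series_exp_bound _ (f / 2) (M * (2 / f))).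
- by rewrite divr_gt0.
- by move=> n; rewrite mulr_ge0.
move=> n; have M0 : 0 <= M := le_trans (a_ge0 0%N) (a_leM 0%N).
have h : n.+1%:R <= 2 / f * expR (f / 2 * n.+1%:R).
  rewrite [leLHS](_ : _ = 2 / f * (f / 2 * n.+1%:R)); last by field; rewrite gt_eqF.
  rewrite ler_pM2l ?divr_gt0//; apply: le_trans (expR_ge1Dx _).
  by rewrite lerDr.
apply: (@le_trans _ _ (2 / f * expR (f / 2 * n.+1%:R) * (M * expR (- f * n.+1%:R)))).
  by apply: ler_pM => //; rewrite ler_wpM2r// expR_ge0.
rewrite mulrACA -expRD [2 / f * M]mulrC ler_wpM2l ?mulr_ge0//.
  by rewrite invr_ge0 ltW.
rewrite ler_expR -(natr1 n).
by rewrite -subr_ge0 [leRHS](_ : _ = f / 2); [rewrite divr_ge0// ltW|field].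
Qed.

Lemma mean_gt0 : 0 < limn (series (fun n => n.+1%:R * b n)).
Proof.
have nd : nondecreasing_seq (series (fun k => k.+1%:R * b k)).
  by apply/nondecreasing_seqP => m; rewrite /series/= big_nat_recr//= lerDl mulr_ge0.
have := nondecreasing_cvgn_ub _ _ _ 1%N nd is_cvg_mean.
rewrite {1}/series/= big_nat1 mul1r; apply: lt_le_trans.
by rewrite mulr_gt0// expR_gt0.
Qed.

Lemma cvg_visit :
  v @ \oo --> (limn (series (fun n => n.+1%:R * b n)))^-1.
Proof.
apply: (renewal_cvg b b_ge0 _ b_sum v v0 v_rec _ is_cvg_mean).
by rewrite mulr_gt0// expR_gt0.
Qed.

Let surv_ge0 n : 0 <= surv n.
Proof. by rewrite mulr_ge0// ?expR_ge0//; case/andP: (p01 n). Qed.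

Lemma is_cvg_survival : cvgn (series surv).
Proof.
apply: (@cvg_series_exp_bound _ f 1) => // n.
by rewrite mulrC ler_pM// ?expR_ge0//; case/andP: (p01 n).
Qed.

Lemma survival_gt0 : 0 < limn (series surv).
Proof.
have nd : nondecreasing_seq (series surv).
  by apply/nondecreasing_seqP => m; rewrite /series/= big_nat_recr//= lerDl.
have := nondecreasing_cvgn_ub _ _ _ 1%N nd is_cvg_survival.
rewrite {1}/series/= big_nat1 {1}/surv p0 mulr0 expR0 mulr1.
exact: lt_le_trans.
Qed.

Lemma cvg_free (z : nat -> R) :
  (forall n, z n = \sum_(k < n.+1) p k * u (n - k)%N) ->
  (fun n => z n * expR (- f * n%:R)) @ \oo -->
  (limn (series (fun n => n.+1%:R * b n)))^-1 * limn (series surv).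
Proof.
move=> zE.
have v1 n : `|v n| <= 1.
  by rewrite ger0_norm ?(renewal_ge0 b b_ge0 v v0 v_rec)// (renewal_le1 b b_ge0 b_sum v v0 v_rec).
have := cvg_convolution _ v surv _ _ v1 surv_ge0 cvg_visit is_cvg_survival.
rewrite (_ : (fun n => \sum_(k < n.+1) _) = fun n => z n * expR (- f * n%:R))//.
apply/funext => n; rewrite zE mulr_suml; apply: eq_bigr => k _.
have kn : (k <= n)%N by rewrite -ltnS.
have -> : expR (- f * n%:R) = expR (- f * (n - k)%:R) * expR (- f * k%:R).
  by rewrite -expRD -mulrDr -natrD subnK.
by rewrite /v /surv; ring.
Qed.

End exponential_renewal.

(** * Renewal equations for the partition functions *)

(** [gamma * q (n + 1)], the weight of an excursion of length [n + 1] away from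
    zero. *)
Definition excursion_weight (R : realType) (s : setup) (V : R -> \bar R) (n : nat) : \bar R :=
  iter n (site_op s (step_density s V) (0%:nng)%R) (return_kernel (step_density s V)) 0%R.

Section partition_functions.
Context {R : realType} (s : setup) (V : R -> \bar R).
Hypothesis V_gtNy : forall x, (-oo < V x)%E.
Hypothesis V_cont : s = ContinuousSetup -> continuous (fun x => expeR (- V x)%E).
Context (k : R) (k_gt0 : 0 < k) (kE : kappa s V = k%:E).
Local Notation r := (step_density s V).
Let r0 := step_density_ge0 s V.
Let mr := measurable_step_density s V V_gtNy V_cont.
Local Notation op eps := (site_op s r eps).
Local Open Scope ereal_scope.
Local Notation excursion n := (excursion_weight R s V n).

Lemma div_kappa n x : (k ^+ n)%:E * x / kappa s V ^+ n = x.
Proof.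
have kn : (k ^+ n != 0)%R by rewrite expf_neq0// gt_eqF.
by rewrite kE -EFin_expe inver (negbTE kn) muleAC -EFinM divff// mul1e.
Qed.

Lemma excursion_ge0 n : 0 <= excursion n.
Proof. by apply: iter_site_op_ge0 => // x; rewrite lee_fin. Qed.

Lemma ZcE_div n : Zc s V (0%:nng)%R n / kappa s V ^+ n.+1 = excursion n.
Proof. by rewrite (ZcE s V V_gtNy V_cont k)// div_kappa. Qed.

Lemma gammaE : gamma s V = \sum_(0 <= n <oo) excursion n.
Proof.
by apply: eseries_shift1 => n; [exact: excursion_ge0|rewrite /= ZcE_div].
Qed.

Lemma excursion_le_gamma n : excursion n <= gamma s V.
Proof.
rewrite gammaE; apply: le_trans (nneseries_lim_ge n.+1 _) => [|i _ _]; last first.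
  exact: excursion_ge0.
rewrite big_nat_recr//= leeDr//; apply: sume_ge0 => i _; exact: excursion_ge0.
Qed.

Lemma qSE n : q s V n.+1 = (gamma s V)^-1 * excursion n.
Proof. by rewrite /q /= ZcE_div. Qed.

(** An excursion of length one stays at zero, with weight
    [exp (- V 0) / kappa]. *)
Lemma excursion0_gt0 : V 0%R < +oo -> 0 < excursion 0.
Proof.
move=> V0; rewrite /excursion_weight /= /return_kernel oppr0 lte_fin.
rewrite -(pmulr_rgt0 _ k_gt0) -lte_fin (step_densityE s V V_gtNy k)//.
  by apply: expeR_gt0; rewrite lteNr.
exact: base_support0.
Qed.

Section pinned.
Variable delta : {nonneg R}.
Local Notation eps := (pinning s V delta).

Lemma ZtcS n : Ztc s V delta n.+1 = eps%:num%:E * iter n (op eps) (return_kernel r) 0%R.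
Proof. by rewrite /Ztc (ZcE s V V_gtNy V_cont k)// muleCA div_kappa. Qed.

Lemma ZtfE n : Ztf s V delta n = iter n (op eps) (cst 1) 0%R.
Proof. by rewrite /Ztf (ZfE s V V_gtNy V_cont k)// div_kappa. Qed.

(** The last-visit decomposition at height zero; the configurations that never
    visit zero are the term with [Ztc 0 = 1]. *)
Lemma last_visit_Ztc (phi : R -> \bar R) n :
  (forall x, 0 <= phi x) -> measurable_fun [set: measurableTypeR R] phi ->
  iter n (op eps) phi 0%R =
  \sum_(j < n.+1) iter j (op (0%:nng)%R) phi 0%R * Ztc s V delta (n - j)%N.
Proof.
move=> phi0 mphi; rewrite (last_visit s r r0 mr)// [RHS](reindex_inj rev_ord_inj)/=.
rewrite [RHS]big_ord_recl/= subSS subn0 subnn mule1; congr (_ + _).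
apply: eq_bigr => j _; have jn : (j.+1 <= n)%N by [].
rewrite /bump/= add1n subSS subKn// ZtcS.
by rewrite muleA; congr (_ * _); exact: muleC.
Qed.

Lemma Ztc_renewal n : Ztc s V delta n.+1 =
  \sum_(j < n.+1) eps%:num%:E * excursion j * Ztc s V delta (n - j)%N.
Proof.
rewrite ZtcS last_visit_Ztc//; last 2 first.
- by move=> x; rewrite lee_fin.
- exact: measurable_return_kernel.
have Zt0 j : 0 <= Ztc s V delta j.
  case: j => [|j]; first exact: lee01.
  by rewrite ZtcS mule_ge0// iter_site_op_ge0// => x; rewrite lee_fin.
rewrite ge0_sume_distrr; last by move=> j _; rewrite mule_ge0// excursion_ge0.
by apply: eq_bigr => j _; rewrite muleA.
Qed.

Lemma Ztf_convolution n : Ztf s V delta n =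
  \sum_(j < n.+1) iter j (op (0%:nng)%R) (cst 1) 0%R * Ztc s V delta (n - j)%N.
Proof. by rewrite ZtfE last_visit_Ztc. Qed.

End pinned.

End partition_functions.

(** * Asymptotics of the partition functions *)

(** If [kappa = 0] then the formula for the law gives total mass
    [+oo * 0 = 0]. *)
Lemma kappa_gt0 (R : realType) (s : setup) (V : R -> \bar R)
    (d : measure_display) (T : measurableType d) (P : probability T R)
    (X : {RV P >-> R}) :
  has_step_law s V X -> (0 < kappa s V)%E.
Proof.
move=> /(_ setT measurableT) H; rewrite lt_neqAle; apply/andP; split; last first.
  by apply: integral_ge0 => x _; exact: expeR_ge0.
apply/eqP => k0; move: H.
rewrite -/(kappa s V) -k0 mule0 probability_setT => /eqP.
by rewrite onee_eq0.
Qed.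

Arguments kappa_gt0 {R s V d T P X}.

(** If [gamma = +oo] then [gamma^-1 = 0], so [q] vanishes identically. *)
Lemma gamma_lty (R : realType) (s : setup) (V : R -> \bar R) (F : nat -> \bar R) (c : \bar R) :
  (c * \sum_(1 <= t <oo) q s V t * F t = 1)%E -> (gamma s V < +oo)%E.
Proof.
move=> H; rewrite ltey; apply/eqP => gy; move: H.
rewrite eseries0 => [|t _ _]; last by rewrite /q gy invey !mul0e.
by rewrite mule0 => /eqP; rewrite eq_sym onee_eq0.
Qed.

Arguments gamma_lty {R s V F c}.

Theorem lemma3p3 (R : realType) (s : setup) (V : R -> \bar R)
    (V_gtNy : forall x, (-oo < V x)%E)
    (V0_lty : (V 0%R < +oo)%E)
    (kappa_lty : (kappa s V < +oo)%E)
    (V_cont : s = ContinuousSetup -> continuous (fun x => expeR (- V x)%E))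
    (d : measure_display) (T : measurableType d) (P : probability T R)
    (Y : nat -> {RV P >-> R})
    (Y_indep : mutually_independent Y)
    (Y_law : forall i, has_step_law s V (Y i))
    (Y_integrable : P.-integrable setT (EFin \o Y 0%N))
    (Y_centered : ('E_P[Y 0%N] = 0)%E)
    (Y_variance : slowly_varying (truncated_variance (Y 0%N)))
    (delta : {nonneg R}) (delta_gt1 : 1 < delta%:num)
    (f : R) (f_gt0 : 0 < f)
    (f_eq : (delta%:num%:E *
             \sum_(1 <= t <oo) q s V t * (expR (- f * t%:R))%:E = 1)%E) :
  [/\ (mu_delta s V delta f < +oo)%E,
      asymp_equiv (Ztc s V delta)
        (fun N => ((mu_delta s V delta f)^-1 * (expR (N%:R * f))%:E)%E)
    & asymp_equiv (Ztf s V delta)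
        (fun N => ((mu_delta s V delta f)^-1 *
                   (\sum_(0 <= t <oo)
                      (expR (- f * t%:R))%:E * prob_positive Y t)
                   * (expR (N%:R * f))%:E)%E)].
Proof.
have k_gt0 := kappa_gt0 (Y_law 0%N).
pose k := fine (kappa s V).
have kE : kappa s V = k%:E by rewrite fineK// ge0_fin_numE// ltW.
have {}k_gt0 : 0 < k by rewrite -lte_fin -kE.
pose c := excursion_weight R s V.
have c_ge0 n : (0 <= c n)%E by exact: (excursion_ge0 s V).
have c_le n : (c n <= gamma s V)%E by exact: (excursion_le_gamma s V V_gtNy V_cont k).
have c0_gt0 : (0 < c 0%N)%E by exact: (excursion0_gt0 s V V_gtNy k).
have gamma_gt0 : (0 < gamma s V)%E := lt_le_trans c0_gt0 (c_le 0%N).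
have gammay := gamma_lty f_eq.
pose g := fine (gamma s V).
have gE : gamma s V = g%:E by rewrite fineK// ge0_fin_numE// ltW.
have g_gt0 : 0 < g by rewrite -lte_fin -gE.
have c_fin n : c n \is a fin_num.
  by rewrite ge0_fin_numE//; exact: le_lt_trans (c_le n) gammay.
pose a n := delta%:num / g * fine (c n).
have eps_gt0 : 0 < delta%:num / g by rewrite divr_gt0//; lra.
have epsE : (pinning s V delta)%:num = delta%:num / g by [].
have aE n : ((pinning s V delta)%:num%:E * c n = (a n)%:E)%E.
  by rewrite epsE /a [RHS]EFinM fineK.
have a_ge0 n : 0 <= a n by apply: mulr_ge0; [exact: ltW|exact: fine_ge0].
have a_le n : a n <= delta%:num.
  rewrite /a mulrAC ler_pdivrMr// ler_wpM2l//.
  by rewrite -lee_fin fineK// -gE.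
have a0_gt0 : 0 < a 0%N by rewrite mulr_gt0// fine_gt0// c0_gt0 ltey_eq c_fin.
have deltaq n : (delta%:num%:E * q s V n.+1 = (a n)%:E)%E.
  rewrite (qSE s V V_gtNy V_cont k k_gt0 kE) gE inver gt_eqF//.
  by rewrite -aE epsE EFinM muleA.
pose b n := a n * expR (- f * n.+1%:R).
have b_ge0 n : 0 <= b n by rewrite mulr_ge0// expR_ge0.
have q_ge0 t : (0 <= q s V t)%E.
  rewrite mule_ge0 ?inve_ge0 ?gamma_ge0// mule_ge0//.
    by apply: iterated_integral_ge0 => x; exact: expeR_ge0.
  by rewrite inve_ge0 kE expe_ge0// lee_fin ltW.
have b_sum : series b @ \oo --> (1 : R).
  apply: cvg_series_EFin => //; rewrite -f_eq -nneseriesZl; last first.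
    by move=> i _; rewrite mule_ge0// lee_fin expR_ge0.
  apply/esym/eseries_shift1 => [n|n]; first by rewrite lee_fin.
  by rewrite muleA deltaq -EFinM.
pose u n := fine (Ztc s V delta n).
have ZtcE n : Ztc s V delta n = (u n)%:E.
  rewrite fineK//; elim/ltn_ind: n => -[|n] IH //.
  rewrite (Ztc_renewal s V V_gtNy V_cont k k_gt0 kE); apply/sum_fin_numP => j _ _.
  by rewrite aE fin_numM// IH// ltnS leq_subr.
have u0 : u 0%N = 1 by [].
have u_rec n : u n.+1 = \sum_(j < n.+1) a j * u (n - j)%N.
  apply: EFin_inj; rewrite -ZtcE (Ztc_renewal s V V_gtNy V_cont k k_gt0 kE) -sumEFin.
  by apply: eq_bigr => j _; rewrite aE ZtcE -EFinM.
pose p n := fine (prob_positive Y n).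
have pE n : prob_positive Y n = (p n)%:E.
  by rewrite fineK// fin_num_measure//; exact: measurable_stays_positive.
have p01 n : 0 <= p n <= 1.
  rewrite -!lee_fin -pE measure_ge0 probability_le1//.
  exact: measurable_stays_positive.
have p0 : p 0%N = 1.
  by apply: EFin_inj; rewrite -pE -[LHS]/(P (stays_positive Y 0)) stays_positive0 probability_setT.
have Ztf_sum n : Ztf s V delta n = (\sum_(j < n.+1) p j * u (n - j)%N)%:E.
  rewrite (Ztf_convolution s V V_gtNy V_cont k k_gt0 kE) -sumEFin.
  apply: eq_bigr => j _; rewrite ZtcE EFinM -pE.
  by rewrite (prob_positiveE Y_indep s V V_gtNy V_cont Y_law k).
set mu := limn (series (fun n => n.+1%:R * b n)).
have mean := is_cvg_mean f delta%:num a f_gt0 a_ge0 a_le.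
have mu_gt0 : 0 < mu := mean_gt0 f delta%:num a f_gt0 a_ge0 a_le a0_gt0.
have muE : mu_delta s V delta f = mu%:E.
  rewrite -(eseries_EFin _ _ mean); apply: eseries_shift1 => [n|n].
    by rewrite lee_fin mulr_ge0//; exact: b_ge0.
  by rewrite /q_delta deltaq -!EFinM.
set S := limn (series (fun n => expR (- f * n%:R) * p n)).
have SE : (\sum_(0 <= t <oo) (expR (- f * t%:R))%:E * prob_positive Y t = S%:E)%E.
  rewrite -(eseries_EFin _ _ (is_cvg_survival f p f_gt0 p01)).
  by apply: eq_eseriesr => n _; rewrite pE EFinM.
have S_gt0 : 0 < S := survival_gt0 f p f_gt0 p01 p0.
have undo (w : nat -> R) n : w n = w n * expR (- f * n%:R) * expR (n%:R * f).
  by rewrite -mulrA -expRD mulNr mulrC [f * _]mulrC addNr expR0 mul1r.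
split.
- by rewrite muE ltry.
- rewrite muE inver gt_eqF// (funext ZtcE) (funext (fun n => congr1 EFin (undo u n))).
  under [X in asymp_equiv _ X]eq_fun do rewrite -EFinM.
  apply: asymp_equiv_EFin; first by rewrite invr_eq0 gt_eqF.
  exact: cvg_visit.
- rewrite muE SE inver gt_eqF// (funext Ztf_sum).
  rewrite (funext (fun n => congr1 EFin (undo (fun n => \sum_(j < n.+1) p j * u (n - j)%N) n))).
  under [X in asymp_equiv _ X]eq_fun do rewrite -!EFinM.
  apply: asymp_equiv_EFin; first by rewrite mulf_neq0 ?invr_eq0 ?gt_eqF.
  by apply: (cvg_free f delta%:num a u p).
Qed.
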